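(* There is an absolute constant $c_0$ such that the following holds. Let $\alpha(n)$ be a function with $\alpha(n)\le n/2-5\log n$, let $\beta(n)=\alpha(n)-\log n-3\log\alpha(n)$, let $s(n)$ be a function with $s(n)\le n-\alpha(n)-2\log n-c_0$, and let $l(n)$ be a function with $l(n)\ge\beta(n)+8\log n$. Then there are no computable functions $f_1:\{0,1\}^n\times\{0,1\}^n\to\{0,1\}^{l(n)}$ and $f_2:\{0,1\}^n\times\{0,1\}^n\to\{0,1\}^{l(n)}$ satisfying the Dependency Reduction Task for parameters $\alpha(n),\beta(n),s(n),l(n)$ and $a=8$.
   Context: $C(\cdot)$ denotes plain Kolmogorov complexity with respect to a fixed universal Turing machine and $C(x\mid y)$ plain conditional Kolmogorov complexity. All logarithms are base 2. The dependency of strings $x,y$ is ${\rm dep}(x,y)=\max\{C(x)-C(x\mid y),\,C(y)-C(y\mid x)\}$. Two functions $f_1,f_2:\{0,1\}^n\times\{0,1\}^n\to\{0,1\}^{l(n)}$ satisfy the Dependency Reduction Task for parameters $\alpha(n),\beta(n),s(n),l(n),a$ if for all $n$ and all $x,y\in\{0,1\}^n$ with ${\rm dep}(x,y)\le\alpha(n)$, $C(x)\ge s(n)$ and $C(y)\ge s(n)$, the following hold: (1) ${\rm dep}(f_1(x,y),f_2(x,y))\le\beta(n)$; (2) $C(f_1(x,y))\ge\beta(n)+a\log n$ and $C(f_2(x,y))\ge\beta(n)+a\log n$.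
   Formalization: The formal theorem also assumes α(n) ≥ c_0 for all large n (without such a bound the claim fails, e.g. for α(n)=2^(-n/10)), and it requires the conditions on α, β, s, l only for all sufficiently large n. *)

(* Defs.v *)
(* Stdlib world: concrete reals [R], bit strings as [list bool]. *)
From Stdlib Require Import Reals List Arith Lia ClassicalEpsilon.
Import ListNotations.
Open Scope R_scope.

(** * Partial computable functions *)

(* Programs of the class of partial (mu-)recursive functions on nat.  The
   argument vector is a plain list; a program applied to too few arguments is
   undefined. *)
Inductive prog : Type :=
| Zero : prog
| Succ : prog
| Proj : nat -> prog
| Comp : prog -> list prog -> prog
| Prec : prog -> prog -> prog
| Mu : prog -> prog.

(* [eval c v a]: program [c] halts on arguments [v] with output [a]. *)
Inductive eval : prog -> list nat -> nat -> Prop :=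
| eval_zero v : eval Zero v 0
| eval_succ a v : eval Succ (a :: v) (S a)
| eval_proj i v a : nth_error v i = Some a -> eval (Proj i) v a
| eval_comp f gs v w b : evals gs v w -> eval f w b -> eval (Comp f gs) v b
| eval_prec_0 f g v b : eval f v b -> eval (Prec f g) (0%nat :: v) b
| eval_prec_S f g n v a b :
    eval (Prec f g) (n :: v) a -> eval g (n :: a :: v) b ->
    eval (Prec f g) (S n :: v) b
(* Unbounded search is undefined if the search meets a divergent value before
   the first zero. *)
| eval_mu f v n (w : nat -> nat) :
    (forall k, (k < n)%nat -> eval f (k :: v) (S (w k))) ->
    eval f (n :: v) 0 -> eval (Mu f) v n
with evals : list prog -> list nat -> list nat -> Prop :=
| evals_nil v : evals [] v []
| evals_cons g gs v a w :
    eval g v a -> evals gs v w -> evals (g :: gs) v (a :: w).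

(** * Bit strings *)

Definition bits := list bool.

(* The usual bijection between binary strings and natural numbers (bijective
   base 2, digits 1 and 2, least significant digit first). *)
Fixpoint bits_code (x : bits) : nat :=
  match x with
  | [] => 0
  | b :: x' => (if b then 2 else 1) + 2 * bits_code x'
  end%nat.

(* [run M p y x]: machine [M] with input [p] and conditioning string [y]
   halts with output [x]. *)
Definition run (M : prog) (p y x : bits) : Prop :=
  eval M [bits_code p; bits_code y] (bits_code x).

(* [C_U(x|y) <= C_M(x|y) + O(1)] for every machine [M], the constant depending
   only on [M]. *)
Definition universal (U : prog) : Prop :=
  forall M : prog, exists c : nat, forall p x y : bits,
    run M p y x -> exists q : bits, run U q y x /\ (length q <= length p + c)%nat.

(** * Plain Kolmogorov complexity *)

Definition min_description_length (U : prog) (x y : bits) (k : nat) : Prop :=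
  (exists p : bits, run U p y x /\ length p = k) /\
  (forall p : bits, run U p y x -> (k <= length p)%nat).

(* The minimum exists when [U] is universal (see [Ccond_spec]); otherwise the
   value may be arbitrary. *)
Definition Ccond (U : prog) (x y : bits) : nat :=
  epsilon (inhabits 0%nat) (min_description_length U x y).

Definition C (U : prog) (x : bits) : nat := Ccond U x [].

Lemma Ccond_spec (U : prog) (x y : bits) :
  universal U -> min_description_length U x y (Ccond U x y).
Proof.
intros HU. unfold Ccond; apply epsilon_spec.
destruct (HU (Proj 0)) as [c Hc].
destruct (Hc x x y) as [q [Hq _]]; [now constructor|].
clear c Hc. remember (length q) as m eqn:Em. revert q Em Hq.
induction m as [m IH] using lt_wf_ind; intros q Em Hq.
destruct (excluded_middle_informative
            (exists p, run U p y x /\ (length p < m)%nat)) as [[p [Hp Hlt]]|Hno].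
- exact (IH (length p) Hlt p eq_refl Hp).
- exists m; split; [now exists q|].
  intros p Hp. destruct (Nat.le_gt_cases m (length p)) as [|Hlt]; [assumption|].
  exfalso; apply Hno; now exists p.
Qed.

Definition dep (U : prog) (x y : bits) : R :=
  Rmax (INR (C U x) - INR (Ccond U x y)) (INR (C U y) - INR (Ccond U y x)).

(** * Dependency reduction *)

Definition log2 (x : R) : R := ln x / ln 2.

(* A family of functions [{0,1}^n * {0,1}^n -> {0,1}^(l n)], one for each [n],
   is a single binary function on strings; its values on pairs of strings of
   different lengths are irrelevant. *)
Definition maps_lengths (l : nat -> nat) (f : bits -> bits -> bits) : Prop :=
  forall x y : bits, length x = length y -> length (f x y) = l (length x).

Definition computable (f : bits -> bits -> bits) : Prop :=
  exists M : prog, forall x y : bits, length x = length y -> run M x y (f x y).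

Definition dependency_reduction (U : prog) (alpha beta s : nat -> R)
    (l : nat -> nat) (a : R) (f1 f2 : bits -> bits -> bits) : Prop :=
  maps_lengths l f1 /\ maps_lengths l f2 /\
  forall (n : nat) (x y : bits), length x = n -> length y = n ->
    dep U x y <= alpha n -> s n <= INR (C U x) -> s n <= INR (C U y) ->
    dep U (f1 x y) (f2 x y) <= beta n /\
    beta n + a * log2 (INR n) <= INR (C U (f1 x y)) /\
    beta n + a * log2 (INR n) <= INR (C U (f2 x y)).

Definition for_large (P : nat -> Prop) : Prop :=
  exists N : nat, forall n : nat, (N <= n)%nat -> P n.

(* Main.v *)
(** Fix [n] and [m], roughly [alpha n - log n], and let [u] range over the pairs
    [(x, y)] of strings of length [n].  A probabilistic argument gives a relation
    [G] on the outputs which holds for at least a fraction [2^-(m+1)] of all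
    [u], but which is nowhere denser than [4 * 2^-m] on rectangles with sides at
    least [4 n 2^m]; as these are decidable conditions, such a [G] can be found
    by exhaustive search.  So many pairs are related that one of them has
    [C(x|y), C(y|x) >= n - m - O(1)], hence dependency at most [alpha n].  Let
    [z1, z2] be its outputs and [k = C(z1)].  If at most [2^(k+3-m)] strings of
    complexity at most [k] are related to [z2], then [z1] is determined by its
    rank in their enumeration, so that [C(z1|z2) <= k - m] up to small terms and
    [z1, z2] are too dependent.  Otherwise [z2] is one of the fewer than
    [4 n 2^m] exceptional strings, which are enumerable, and so [C(z2)] is too
    small.  The description of [n] must be short compared with [log alpha]; it
    suffices to refute the reduction at [n = 2^2^2^j] for one large [j]. *)

Require Import Defs.
From Stdlib Require Import Reals List.
From Stdlib Require Import ZArith Lia Lra Bool.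
Import ListNotations.

Open Scope nat_scope.

(** * Recursive functions *)

(** The two cases are paid from different terms. If [z2] is not exceptional, [z1] costs about
    [k - m + 2 log m + j] bits given [z2]; since [m > alpha - log n - 1], the dependency is at least
    [alpha - log n - 2 log alpha - j - O(1)]. Two of the three terms [log alpha] in [beta] thus
    encode [m], and the third must exceed [j] plus constants that depend on [f1] and [f2]. It does,
    because either [alpha] is at least half of [log n = 2^2^j], or [beta] lies below a bound that
    every dependency respects and the reduction fails at once. In the exceptional case [z2] costs
    [m + log n + 2] bits for its rank and about [2 log n] bits for [k], that is [m + 3 log n] up to
    [j + O(1)], whereas [beta + 8 log n] is at least [m + 5 log n]. The estimate of [log k] needs
    [k = O(n)]; as [l(n)] may be huge, it comes from the number of input pairs and not from the
    length of the outputs. *)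

Definition Rec (k : nat) (F : list nat -> nat) : Prop :=
  exists c, forall v, length v = k -> eval c v (F v).

(** [Rec] speaks of Rocq functions and constrains them only on vectors of length [k], so a function
    may be replaced by any other that agrees with it there. *)
Lemma Rec_ext k F G :
  (forall v, length v = k -> F v = G v) -> Rec k F -> Rec k G.
Proof.
  intros HFG [c Hc]; exists c; intros v Hv; rewrite <- HFG by exact Hv; auto.
Qed.

Lemma Rec_nth k i : i < k -> Rec k (fun v => nth i v 0).
Proof.
  intros Hi; exists (Proj i); intros v Hv; constructor.
  apply nth_error_nth'; lia.
Qed.

Lemma Rec_comp k F Gs :
  Rec (length Gs) F -> Forall (Rec k) Gs ->
  Rec k (fun v => F (map (fun g => g v) Gs)).
Proof.
  intros [c Hc] HGs.
  assert (Hcs : exists cs, forall v, length v = k ->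
            evals cs v (map (fun g => g v) Gs)).
  { clear F c Hc; induction HGs as [|G Gs [g Hg] _ [cs Hcs]].
    - exists []; intros; constructor.
    - exists (g :: cs); intros v Hv; simpl; constructor; auto. }
  destruct Hcs as [cs Hcs]; exists (Comp c cs); intros v Hv.
  econstructor; [apply Hcs, Hv | apply Hc; now rewrite length_map].
Qed.

Lemma Rec_comp1 k F A :
  Rec 1 (fun v => F (nth 0 v 0)) -> Rec k A -> Rec k (fun v => F (A v)).
Proof. intros HF HA; apply (Rec_comp k _ [A] HF); auto. Qed.

Lemma Rec_comp2 k F A B :
  Rec 2 (fun v => F (nth 0 v 0) (nth 1 v 0)) -> Rec k A -> Rec k B ->
  Rec k (fun v => F (A v) (B v)).
Proof. intros HF HA HB; apply (Rec_comp k _ [A; B] HF); auto. Qed.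

Lemma Rec_comp5 k F A1 A2 A3 A4 A5 :
  Rec 5 (fun v => F (nth 0 v 0) (nth 1 v 0) (nth 2 v 0) (nth 3 v 0) (nth 4 v 0)) ->
  Rec k A1 -> Rec k A2 -> Rec k A3 -> Rec k A4 -> Rec k A5 ->
  Rec k (fun v => F (A1 v) (A2 v) (A3 v) (A4 v) (A5 v)).
Proof.
  intros HF H1 H2 H3 H4 H5; apply (Rec_comp k _ [A1; A2; A3; A4; A5] HF); auto 7.
Qed.

Lemma Rec_S k A : Rec k A -> Rec k (fun v => S (A v)).
Proof.
  apply (Rec_comp1 k S); exists Succ; intros [|a v]; [discriminate|].
  intros _; constructor.
Qed.

Lemma Rec_const k a : Rec k (fun _ => a).
Proof.
  induction a as [|a IH]; [|now apply Rec_S].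
  exists Zero; intros; constructor.
Qed.

Lemma map_nth_seq (v u : list nat) :
  map (fun i => nth i (u ++ v) 0) (seq (length u) (length v)) = v.
Proof.
  revert u; induction v as [|a v IH]; intros u; simpl; [reflexivity|].
  rewrite app_nth2, Nat.sub_diag by lia; simpl; f_equal.
  specialize (IH (u ++ [a])); rewrite length_app in IH; simpl in IH.
  rewrite Nat.add_1_r in IH; rewrite <- IH at 2.
  now rewrite <- app_assoc.
Qed.

Lemma Rec_cons_select k F A idx :
  Rec (S (length idx)) F -> Rec k A -> (forall i, In i idx -> i < k) ->
  Rec k (fun v => F (A v :: map (fun i => nth i v 0) idx)).
Proof.
  intros HF HA Hidx.
  apply (Rec_ext _ (fun v => F (map (fun g => g v)
           (A :: map (fun i v => nth i v 0) idx)))).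
  - intros v _; simpl; now rewrite map_map.
  - apply Rec_comp; [simpl; now rewrite length_map|].
    constructor; [assumption|].
    apply Forall_map, Forall_forall; intros i Hi; apply Rec_nth; auto.
Qed.

Lemma Rec_hd k : Rec (S k) (fun v => hd 0 v).
Proof.
  apply (Rec_ext _ (fun v => nth 0 v 0)); [now intros [|]|apply Rec_nth; lia].
Qed.

Lemma Rec_tl k A : Rec k A -> Rec (S k) (fun v => A (tl v)).
Proof.
  intros HA.
  apply (Rec_ext _ (fun v => A (map (fun g => g v)
           (map (fun i v => nth i v 0) (seq 1 k))))).
  - intros [|a v]; [discriminate|]; intros [= <-]; simpl tl.
    rewrite map_map; f_equal; apply (map_nth_seq v [a]).
  - apply Rec_comp.
    + now rewrite length_map, length_seq.
    + apply Forall_map, Forall_forall; intros i Hi; apply in_seq in Hi.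
      apply Rec_nth; lia.
Qed.

(** The step of a recursion sees counter, accumulator and parameters. A body that depends on counter
    and parameters only is moved there by dropping the second entry. *)
Lemma Rec_skip k F :
  Rec (S k) (fun w => F (hd 0 w) (tl w)) ->
  Rec (S (S k)) (fun w => F (hd 0 w) (tl (tl w))).
Proof.
  intros HF.
  apply (Rec_ext _ (fun v => (fun w => F (hd 0 w) (tl w))
           (hd 0 v :: map (fun i => nth i v 0) (seq 2 k)))).
  - intros [|i [|a v]]; try discriminate; intros [= <-]; cbn [hd tl].
    f_equal; apply (map_nth_seq v [i; a]).
  - apply (Rec_cons_select _ (fun w => F (hd 0 w) (tl w))).
    + now rewrite length_seq.
    + apply Rec_hd.
    + intros i Hi; apply in_seq in Hi; lia.
Qed.

(** [Prec] consumes the head of its vector, so the recursion argument is computed first and the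
    whole environment is copied behind it by projections; base and step may then use every variable
    in scope. *)
Lemma Rec_nat_rect k A F0 G :
  Rec k A -> Rec k F0 ->
  Rec (S (S k)) (fun w => G (hd 0 w) (hd 0 (tl w)) (tl (tl w))) ->
  Rec k (fun v => nat_rect (fun _ => nat) (F0 v) (fun n a => G n a v) (A v)).
Proof.
  intros HA [c0 H0] [c1 H1].
  set (F := fun w => nat_rect (fun _ => nat) (F0 (tl w))
              (fun n a => G n a (tl w)) (hd 0 w)).
  apply (Rec_ext _ (fun v => F (A v :: map (fun i => nth i v 0) (seq 0 k)))).
  - intros v <-; unfold F; cbn [hd tl].
    replace (map _ (seq 0 (length v))) with v; [reflexivity|].
    symmetry; exact (map_nth_seq v []).
  - apply Rec_cons_select; [|assumption|intros i Hi; apply in_seq in Hi; lia].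
    rewrite length_seq.
    exists (Defs.Prec c0 c1); intros [|n v]; [discriminate|].
    intros [= Hv]; unfold F; cbn [hd tl].
    induction n as [|n IH]; simpl.
    + constructor; auto.
    + econstructor; [exact IH|].
      apply (H1 (n :: _ :: v)); simpl; now rewrite Hv.
Qed.

(* Environments are lists, [hd 0 w] being the innermost bound variable. *)
Ltac rec_rule := fail.
Ltac rec_step :=
  match goal with
  | |- Rec _ (fun _ => _) => apply Rec_const
  | |- Rec _ (hd 0) => apply Rec_hd
  | |- Rec _ (fun v => hd 0 v) => apply Rec_hd
  | |- Rec _ (fun v => nth _ v 0) => apply Rec_nth; lia
  | |- Rec (S ?k) (fun w => nth ?i (tl w) 0) =>
      apply (Rec_tl k (fun v => nth i v 0))
  | |- Rec (S ?k) (fun w => nth ?i (tl (tl w)) 0) =>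
      apply (Rec_tl k (fun v => nth i (tl v) 0))
  | |- Rec (S ?k) (fun w => ?A (tl (tl (tl (tl (tl w)))))) =>
      apply (Rec_tl k (fun v => A (tl (tl (tl (tl v))))))
  | |- Rec (S ?k) (fun w => ?A (tl (tl (tl (tl w))))) =>
      apply (Rec_tl k (fun v => A (tl (tl (tl v)))))
  | |- Rec (S ?k) (fun w => ?A (tl (tl (tl w)))) =>
      apply (Rec_tl k (fun v => A (tl (tl v))))
  | |- Rec (S ?k) (fun w => ?A (tl (tl w))) => apply (Rec_tl k (fun v => A (tl v)))
  | |- Rec (S ?k) (fun w => ?A (tl w)) => apply (Rec_tl k A)
  | |- Rec _ (fun v => S _) => apply Rec_S
  | |- Rec _ _ => assumption
  | |- Rec _ _ => rec_rule
  end.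
Ltac rec := cbv beta; repeat (rec_step; cbv beta).

Definition ite (c a b : nat) : nat := match c with 0 => b | S _ => a end.

Lemma Rec_ite k c A B :
  Rec k c -> Rec k A -> Rec k B -> Rec k (fun v => ite (c v) (A v) (B v)).
Proof.
  intros Hc HA HB.
  apply (Rec_ext _ (fun v => nat_rect (fun _ => nat) (B v) (fun _ _ => A v) (c v))).
  - intros v _; now destruct (c v).
  - apply (Rec_nat_rect k c B (fun _ _ v => A v)); rec.
Qed.

Lemma Rec_add k A B : Rec k A -> Rec k B -> Rec k (fun v => A v + B v).
Proof.
  intros HA HB.
  apply (Rec_ext _ (fun v => nat_rect (fun _ => nat) (B v) (fun _ a => S a) (A v))).
  - intros v _; induction (A v); simpl; congruence.
  - apply (Rec_nat_rect k A B (fun _ a v => S a)); rec.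
Qed.

Lemma Rec_pred k A : Rec k A -> Rec k (fun v => pred (A v)).
Proof.
  intros HA.
  apply (Rec_ext _ (fun v => nat_rect (fun _ => nat) 0 (fun n a => n) (A v))).
  - intros v _; now destruct (A v).
  - apply (Rec_nat_rect k A (fun _ => 0) (fun n _ v => n)); rec.
Qed.
Ltac rec_rule ::= first [apply Rec_ite | apply Rec_add | apply Rec_pred].

Lemma Rec_sub k A B : Rec k A -> Rec k B -> Rec k (fun v => A v - B v).
Proof.
  intros HA HB.
  apply (Rec_ext _ (fun v => nat_rect (fun _ => nat) (A v) (fun _ a => pred a) (B v))).
  - intros v _; induction (B v); simpl; lia.
  - apply (Rec_nat_rect k B A (fun _ a v => pred a)); rec.
Qed.

Lemma Rec_mul k A B : Rec k A -> Rec k B -> Rec k (fun v => A v * B v).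
Proof.
  intros HA HB.
  apply (Rec_ext _ (fun v => nat_rect (fun _ => nat) 0 (fun _ a => B v + a) (A v))).
  - intros v _; induction (A v); simpl; congruence.
  - apply (Rec_nat_rect k A (fun _ => 0) (fun _ a v => B v + a)); rec.
Qed.
Ltac rec_rule ::= first [apply Rec_ite | apply Rec_add | apply Rec_pred | apply Rec_sub
  | apply Rec_mul].

Lemma Rec_pow k A B : Rec k A -> Rec k B -> Rec k (fun v => A v ^ B v).
Proof.
  intros HA HB.
  apply (Rec_ext _ (fun v => nat_rect (fun _ => nat) 1 (fun _ a => A v * a) (B v))).
  - intros v _; induction (B v); simpl; congruence.
  - apply (Rec_nat_rect k B (fun _ => 1) (fun _ a v => A v * a)); rec.
Qed.

(* Predicates are functions to [nat]; nonzero values mean truth. *)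
Definition lef (a b : nat) : nat := 1 - (a - b).
Definition eqf (a b : nat) : nat := 1 - ((a - b) + (b - a)).

Lemma lef_spec a b : lef a b <> 0 <-> a <= b.
Proof. unfold lef; lia. Qed.

Lemma eqf_spec a b : eqf a b <> 0 <-> a = b.
Proof. unfold eqf; lia. Qed.

Lemma Rec_lef k A B : Rec k A -> Rec k B -> Rec k (fun v => lef (A v) (B v)).
Proof. intros HA HB; unfold lef; rec. Qed.

Lemma Rec_eqf k A B : Rec k A -> Rec k B -> Rec k (fun v => eqf (A v) (B v)).
Proof. intros HA HB; unfold eqf; rec. Qed.

(** * Bounded sums and bounded minimisation *)

Fixpoint sum (b : nat) (f : nat -> nat) : nat :=
  match b with 0 => 0 | S b' => sum b' f + f b' end.

Lemma Rec_sum k B F :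
  Rec k B -> Rec (S k) (fun w => F (hd 0 w) (tl w)) ->
  Rec k (fun v => sum (B v) (fun i => F i v)).
Proof.
  intros HB HF.
  apply (Rec_ext _ (fun v => nat_rect (fun _ => nat) 0 (fun i a => a + F i v) (B v))).
  - intros v _; induction (B v); simpl; congruence.
  - apply (Rec_nat_rect k B (fun _ => 0) (fun i a v => a + F i v)); [rec..|].
    apply Rec_add; [rec|]; now apply Rec_skip.
Qed.

Lemma sum_ext b f g : (forall i, i < b -> f i = g i) -> sum b f = sum b g.
Proof.
  induction b as [|b IH]; intros H; simpl; [reflexivity|].
  rewrite IH, H by auto; reflexivity.
Qed.

Lemma sum_0 b f : sum b f = 0 <-> forall i, i < b -> f i = 0.
Proof.
  induction b as [|b IH]; simpl; [split; [intros; lia|reflexivity]|].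
  split.
  - intros H i Hi; destruct (Nat.eq_dec i b) as [->|]; [lia|]; apply IH; lia.
  - intros H; rewrite (H b) by lia; rewrite (proj2 IH); [lia|auto].
Qed.

Lemma sum_nonzero b f : sum b f <> 0 <-> exists i, i < b /\ f i <> 0.
Proof.
  split.
  - induction b as [|b IH]; simpl; [congruence|]; intros H.
    destruct (Nat.eq_dec (f b) 0) as [E|E]; [|now exists b; split; [lia|]].
    destruct IH as [i [Hi Hf]]; [lia|]; exists i; split; [lia|assumption].
  - intros [i [Hi Hf]] H; rewrite sum_0 in H; auto.
Qed.

Lemma sum_le b f g : (forall i, i < b -> f i <= g i) -> sum b f <= sum b g.
Proof.
  induction b as [|b IH]; intros H; simpl; [lia|].
  pose proof (H b); specialize (IH ltac:(auto)); lia.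
Qed.

Lemma sum_const b a : sum b (fun _ => a) = b * a.
Proof. induction b as [|b IH]; simpl; [|rewrite IH]; lia. Qed.

Lemma sum_add b f g : sum b (fun i => f i + g i) = sum b f + sum b g.
Proof. induction b as [|b IH]; simpl; [|rewrite IH]; lia. Qed.

Lemma sum_mul_l b a f : sum b (fun i => a * f i) = a * sum b f.
Proof. induction b as [|b IH]; simpl; [|rewrite IH]; lia. Qed.

Lemma sum_mul_r b a f : sum b (fun i => f i * a) = sum b f * a.
Proof. induction b as [|b IH]; simpl; [|rewrite IH]; lia. Qed.

Lemma sum_swap a b f :
  sum a (fun i => sum b (fun j => f i j)) = sum b (fun j => sum a (fun i => f i j)).
Proof.
  induction a as [|a IH]; simpl.
  - rewrite sum_const; lia.
  - now rewrite IH, sum_add.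
Qed.

Lemma sum_split a b f : sum (a + b) f = sum a f + sum b (fun i => f (a + i)).
Proof.
  induction b as [|b IH]; [rewrite Nat.add_0_r; simpl; lia|].
  rewrite Nat.add_succ_r; simpl; lia.
Qed.

(* Least [i < b] satisfying [P], or [b] if there is none. *)
Definition bmin (b : nat) (P : nat -> nat) : nat :=
  sum b (fun i => 1 - sum (S i) P).

(** A summand of [bmin] is 1 as long as no index up to it satisfies [P] and 0 from then on, so the
    sum counts the indices before the first solution. *)
Lemma bmin_spec b P i :
  i < b -> P i <> 0 -> (forall i', i' < i -> P i' = 0) -> bmin b P = i.
Proof.
  intros Hi HP Hmin; unfold bmin.
  replace b with (i + (b - i)) by lia; rewrite sum_split.
  rewrite (sum_ext i _ (fun _ => 1)), sum_const.
  - rewrite (proj2 (sum_0 (b - i) _)); [lia|].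
    intros d Hd; cut (sum (S (i + d)) P <> 0); [lia|].
    apply sum_nonzero; exists i; split; [lia|assumption].
  - intros i' Hi'; rewrite (proj2 (sum_0 (S i') P)); [lia|].
    intros i'' Hi''; apply Hmin; lia.
Qed.

Lemma least_exists (P : nat -> nat) i :
  P i <> 0 -> exists i0, i0 <= i /\ P i0 <> 0 /\ forall i', i' < i0 -> P i' = 0.
Proof.
  induction i as [i IH] using lt_wf_ind; intros HP.
  destruct (Nat.eq_dec (sum i P) 0) as [E|E].
  - rewrite sum_0 in E; exists i; auto.
  - apply sum_nonzero in E; destruct E as [i' [Hi' HP']].
    destruct (IH i' Hi' HP') as [i0 [? ?]]; exists i0; split; [lia|assumption].
Qed.

Lemma bmin_sat b P : (exists i, i < b /\ P i <> 0) -> bmin b P < b /\ P (bmin b P) <> 0.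
Proof.
  intros [i [Hi HP]]; destruct (least_exists P i HP) as [i0 [Hle [HP0 Hmin]]].
  rewrite (bmin_spec b P i0) by (lia || assumption); split; [lia|assumption].
Qed.

Lemma Rec_bmin k B P :
  Rec k B -> Rec (S k) (fun w => P (hd 0 w) (tl w)) ->
  Rec k (fun v => bmin (B v) (fun i => P i v)).
Proof.
  intros HB HP; unfold bmin.
  apply (Rec_sum k B (fun i v => 1 - sum (S i) (fun i => P i v))); [assumption|].
  apply Rec_sub; [rec|].
  apply (Rec_sum (S k) (fun w => S (hd 0 w)) (fun i w => P i (tl w))); [rec|].
  now apply Rec_skip.
Qed.
Ltac rec_arith :=
  match goal with
  | |- Rec ?k (fun v => sum (@?B v) (fun i => @?F v i)) =>
      apply (Rec_sum k B (fun i v => F v i))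
  | |- Rec ?k (fun v => bmin (@?B v) (fun i => @?F v i)) =>
      apply (Rec_bmin k B (fun i v => F v i))
  | |- _ => first [apply Rec_ite | apply Rec_add | apply Rec_pred | apply Rec_sub
      | apply Rec_mul | apply Rec_pow | apply Rec_lef | apply Rec_eqf]
  end.
Ltac rec_rule ::= rec_arith.

(** * Division by powers of two, binary digits, logarithm *)

Lemma pow2_pos e : 0 < 2 ^ e.
Proof. pose proof (Nat.pow_nonzero 2 e); lia. Qed.

Lemma Rec_div_pow2 k A B : Rec k A -> Rec k B -> Rec k (fun v => A v / 2 ^ B v).
Proof.
  intros HA HB.
  apply (Rec_ext _ (fun v => bmin (S (A v)) (fun q => lef (S (A v)) (2 ^ B v * S q)))).
  - intros v _; pose proof (pow2_pos (B v)).
    apply bmin_spec.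
    + apply Nat.lt_succ_r, Nat.Div0.div_le_upper_bound; nia.
    + apply lef_spec, Nat.mul_succ_div_gt; lia.
    + intros q Hq; cut (~ lef (S (A v)) (2 ^ B v * S q) <> 0); [lia|].
      rewrite lef_spec; intros Hl.
      assert (A v / 2 ^ B v < S q) by (apply Nat.Div0.div_lt_upper_bound; lia).
      lia.
  - apply (Rec_bmin _ _ (fun q v => lef (S (A v)) (2 ^ B v * S q))); rec.
Qed.
Ltac rec_rule ::= first [rec_arith | apply Rec_div_pow2].

Lemma Rec_mod_pow2 k A B : Rec k A -> Rec k B -> Rec k (fun v => A v mod 2 ^ B v).
Proof.
  intros HA HB.
  apply (Rec_ext _ (fun v => A v - 2 ^ B v * (A v / 2 ^ B v))); [|rec].
  intros v _; symmetry; apply Nat.Div0.mod_eq.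
Qed.

Lemma Rec_testbit k A B :
  Rec k A -> Rec k B -> Rec k (fun v => Nat.b2n (Nat.testbit (A v) (B v))).
Proof.
  intros HA HB.
  apply (Rec_ext _ (fun v => A v / 2 ^ B v mod 2 ^ 1)).
  - intros v _; symmetry; apply Nat.testbit_spec'.
  - apply (Rec_mod_pow2 k (fun v => A v / 2 ^ B v) (fun _ => 1)); rec.
Qed.

Lemma Rec_log2 k A : Rec k A -> Rec k (fun v => Nat.log2 (A v)).
Proof.
  intros HA.
  apply (Rec_ext _ (fun v => bmin (A v) (fun e => lef (S (A v)) (2 ^ S e)))).
  - intros v _; destruct (A v) as [|a]; [reflexivity|].
    destruct (Nat.log2_spec (S a)) as [Hl Hu]; [lia|].
    apply bmin_spec.
    + apply Nat.log2_lt_lin; lia.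
    + apply lef_spec; lia.
    + intros e He; cut (~ lef (S (S a)) (2 ^ S e) <> 0); [lia|].
      rewrite lef_spec; intros H.
      assert (2 ^ S e <= 2 ^ Nat.log2 (S a)) by (apply Nat.pow_le_mono_r; lia).
      lia.
  - apply (Rec_bmin _ _ (fun e v => lef (S (A v)) (2 ^ S e))); rec.
Qed.

(** The 2-adic valuation, with value 0 at 0. For positive [a] the bound [a] suffices since [2 ^ i]
    divides [a] only if [i < a]. *)
Definition v2 (a : nat) : nat := bmin a (fun i => Nat.b2n (Nat.testbit a i)).

Lemma Rec_v2 k A : Rec k A -> Rec k (fun v => v2 (A v)).
Proof.
  intros HA; unfold v2.
  apply (Rec_bmin _ _ (fun i v => Nat.b2n (Nat.testbit (A v) i))); [rec|].
  apply Rec_testbit; rec.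
Qed.
Ltac rec_rule ::= first [rec_arith | apply Rec_div_pow2 | apply Rec_mod_pow2
  | apply Rec_testbit | apply Rec_log2 | apply Rec_v2].

(* Self-delimiting pairing: costs [a + 1] bits on top of those of [r]. *)
Definition upair (a r : nat) : nat := 2 ^ a * (2 * r + 1).

Lemma upair_div a r : upair a r / 2 ^ S a = r.
Proof.
  unfold upair; rewrite Nat.pow_succ_r', (Nat.mul_comm 2 (2 ^ a)).
  rewrite <- Nat.Div0.div_div.
  rewrite Nat.mul_comm, Nat.div_mul by (apply Nat.pow_nonzero; lia).
  symmetry; apply (Nat.div_unique _ _ r 1); lia.
Qed.

Lemma v2_upair a r : v2 (upair a r) = a.
Proof.
  unfold v2, upair; apply bmin_spec.
  - pose proof (Nat.pow_gt_lin_r 2 a); nia.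
  - rewrite Nat.mul_comm, Nat.mul_pow2_bits_high, Nat.sub_diag by lia.
    now rewrite Nat.testbit_odd_0.
  - intros i Hi; now rewrite Nat.mul_comm, Nat.mul_pow2_bits_low.
Qed.

Lemma log2_upair a r : r <> 0 -> Nat.log2 (upair a r) = a + 1 + Nat.log2 r.
Proof.
  intros Hr; unfold upair.
  rewrite Nat.mul_comm, Nat.log2_mul_pow2 by lia.
  rewrite Nat.log2_succ_double by lia; lia.
Qed.

(** * Bounded evaluation *)

(* [ev c s v] is [S a] if [c] outputs [a] on [v] with all searches bounded by
   [s], and [0] otherwise. *)
Fixpoint ev (c : prog) (s : nat) (v : list nat) {struct c} : nat :=
  match c with
  | Zero => 1
  | Succ => match v with [] => 0 | a :: _ => S (S a) end
  | Proj i => match nth_error v i with Some a => S a | None => 0 end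
  | Comp f gs =>
      let ws := map (fun g => ev g s v) gs in
      ite (fold_right Nat.mul 1 ws) (ev f s (map pred ws)) 0
  | Defs.Prec f g =>
      match v with
      | [] => 0
      | n :: u => nat_rect (fun _ => nat) (ev f s u)
                    (fun n a => ite a (ev g s (n :: pred a :: u)) 0) n
      end
  | Mu f =>
      let i := bmin s (fun i => lef (ev f s (i :: v)) 1) in
      ite (lef (S i) s * eqf (ev f s (i :: v)) 1) (S i) 0
  end.

Section ProgInd.
Variable P : prog -> Prop.
Hypothesis HZ : P Zero.
Hypothesis HS : P Succ.
Hypothesis HP : forall i, P (Proj i).
Hypothesis HC : forall f gs, P f -> Forall P gs -> P (Comp f gs).
Hypothesis HR : forall f g, P f -> P g -> P (Defs.Prec f g).
Hypothesis HM : forall f, P f -> P (Mu f).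

Fixpoint prog_nested_ind (c : prog) : P c :=
  match c with
  | Zero => HZ
  | Succ => HS
  | Proj i => HP i
  | Comp f gs => HC f gs (prog_nested_ind f)
      ((fix go l := match l return Forall P l with
                    | [] => Forall_nil P
                    | g :: l' => Forall_cons g (prog_nested_ind g) (go l')
                    end) gs)
  | Defs.Prec f g => HR f g (prog_nested_ind f) (prog_nested_ind g)
  | Mu f => HM f (prog_nested_ind f)
  end.
End ProgInd.

Lemma ite_eq_S c a b : ite c a 0 = S b <-> c <> 0 /\ a = S b.
Proof. destruct c; simpl; intuition congruence. Qed.

Lemma ev_sound c : forall s v a, ev c s v = S a -> eval c v a.
Proof.
  induction c as [| |i|f gs IHf IHgs|f g IHf IHg|f IHf] using prog_nested_ind;
    intros s v a; simpl.
  - intros [= <-]; constructor.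
  - destruct v; intros [= <-]; constructor.
  - destruct (nth_error v i) eqn:E; intros [= <-]; now constructor.
  - intros H; apply ite_eq_S in H; destruct H as [Hws Hf].
    econstructor; [|eapply IHf, Hf].
    clear Hf IHf; induction IHgs as [|g gs Hg _ IH]; simpl in *; constructor.
    + apply (Hg s); destruct (ev g s v); simpl in *; [lia|reflexivity].
    + apply IH; lia.
  - destruct v as [|n u]; [discriminate|].
    revert a; induction n as [|n IH]; simpl; intros a H.
    + constructor; eauto.
    + apply ite_eq_S in H; destruct H as [Hr Hg].
      econstructor; [|eapply IHg, Hg].
      apply IH; destruct (nat_rect _ _ _ n); simpl in *; congruence.
  (* The bounded search stops at the first argument whose value is undefined or zero; the factor
     [eqf] rejects the former. All earlier values are therefore defined and positive, as [eval_mu]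
     requires. *)
  - set (i := bmin s _); intros H; apply ite_eq_S in H.
    destruct H as [H [= <-]].
    assert (Hi : i < s) by (cut (lef (S i) s <> 0); [rewrite lef_spec|]; lia).
    assert (H1 : ev f s (i :: v) = 1)
      by (apply eqf_spec; lia).
    destruct (least_exists (fun i => lef (ev f s (i :: v)) 1) i) as [i0 [_ [H0 Hmin]]].
    { apply lef_spec; lia. }
    assert (i0 = i) as ->.
    { symmetry; apply bmin_spec; try assumption.
      destruct (Nat.lt_ge_cases i i0) as [Hlt|]; [|lia].
      apply Hmin in Hlt; unfold lef in Hlt; lia. }
    apply (eval_mu f v i (fun k => pred (pred (ev f s (k :: v))))); [|now apply (IHf s)].
    intros k Hk; apply (IHf s); specialize (Hmin k Hk); unfold lef in Hmin; lia.
Qed.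

Scheme eval_mut := Minimality for eval Sort Prop
with evals_mut := Minimality for evals Sort Prop.

Definition evlist (gs : list prog) (s : nat) (v : list nat) : list nat :=
  map (fun g => ev g s v) gs.

Lemma finite_uniform n (Q : nat -> nat -> Prop) :
  (forall k, k < n -> exists s0, forall s, s0 <= s -> Q k s) ->
  exists s0, forall s, s0 <= s -> forall k, k < n -> Q k s.
Proof.
  induction n as [|n IH]; intros H; [exists 0; lia|].
  destruct IH as [s1 H1]; [auto|].
  destruct (H n) as [s2 H2]; [lia|].
  exists (s1 + s2); intros s Hs k Hk.
  destruct (Nat.eq_dec k n) as [->|]; [apply H2|apply H1]; lia.
Qed.

(** Asking for all large bounds lets the bounds of finitely many subcomputations be added, without a
    separate proof that [ev] is monotone in [s]. *)
Lemma ev_complete c v a :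
  eval c v a -> exists s0, forall s, s0 <= s -> ev c s v = S a.
Proof.
  revert c v a.
  apply (eval_mut
    (fun c v a => exists s0, forall s, s0 <= s -> ev c s v = S a)
    (fun gs v w => exists s0, forall s, s0 <= s -> evlist gs s v = map S w)).
  - exists 0; reflexivity.
  - exists 0; reflexivity.
  - intros i v a H; exists 0; simpl; intros; now rewrite H.
  - intros f gs v w b _ [s1 H1] _ [s2 H2]; exists (s1 + s2); intros s Hs; simpl.
    change (map _ gs) with (evlist gs s v); rewrite H1 by lia.
    rewrite map_map; simpl; rewrite map_id, H2 by lia.
    apply ite_eq_S; split; [|reflexivity].
    clear; induction w; simpl; lia.
  - intros f g v b _ [s0 H]; exists s0; exact H.
  - intros f g n v a b _ [s1 H1] _ [s2 H2]; exists (s1 + s2); intros s Hs.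
    specialize (H1 s ltac:(lia)); simpl in *; rewrite H1; simpl; apply H2; lia.
  - intros f v n w _ H1 _ [s2 H2].
    destruct (finite_uniform n _ H1) as [s1 H1']; exists (s1 + s2 + S n); intros s Hs.
    simpl; rewrite (bmin_spec s _ n).
    + apply ite_eq_S; split; [|reflexivity].
      rewrite H2 by lia; unfold lef, eqf; lia.
    + lia.
    + rewrite H2 by lia; discriminate.
    + intros k Hk; rewrite H1' by lia; unfold lef; lia.
  - exists 0; reflexivity.
  - intros g gs v a w _ [s1 H1] _ [s2 H2]; exists (s1 + s2); intros s Hs; simpl.
    rewrite H1 by lia; f_equal; apply H2; lia.
Qed.

Lemma eval_functional c v a b : eval c v a -> eval c v b -> a = b.
Proof.
  intros Ha Hb; apply ev_complete in Ha, Hb.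
  destruct Ha as [s1 H1], Hb as [s2 H2].
  specialize (H1 (s1 + s2) ltac:(lia)); specialize (H2 (s1 + s2) ltac:(lia)).
  congruence.
Qed.

Lemma Rec_fold_mul k Gs :
  Forall (Rec k) Gs -> Rec k (fun v => fold_right Nat.mul 1 (map (fun g => g v) Gs)).
Proof. induction 1; simpl; rec. Qed.

(** The program is fixed and only the bound and the arguments vary, so induction on [c] replaces a
    universal interpreter and no coding of programs is needed. It is applied to [c = U]. *)
Lemma Rec_ev c : forall r, Rec (S r) (fun w => ev c (hd 0 w) (tl w)).
Proof.
  induction c as [| |i|f gs IHf IHgs|f g IHf IHg|f IHf] using prog_nested_ind; intros r.
  - simpl; rec.
  - destruct r as [|r].
    + apply (Rec_ext _ (fun _ => 0)); [now intros [|? [|]]|rec].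
    + apply (Rec_ext _ (fun w => S (S (hd 0 (tl w))))); [now intros [|? [|]]|rec].
  - destruct (Nat.lt_ge_cases i r) as [Hi|Hi].
    + apply (Rec_ext _ (fun w => S (nth i (tl w) 0))); [|rec].
      intros [|s v] [= Hv]; simpl; now rewrite (nth_error_nth' v 0) by lia.
    + apply (Rec_ext _ (fun w => 0)); [|rec].
      intros [|s v] [= Hv]; simpl.
      now rewrite (proj2 (nth_error_None v i)) by lia.
  - set (Gs := map (fun g w => ev g (hd 0 w) (tl w)) gs).
    assert (HGs : Forall (Rec (S r)) Gs).
    { apply Forall_map; eapply Forall_impl; [|exact IHgs]; auto. }
    set (F := fun w => ev f (hd 0 w) (tl w)).
    apply (Rec_ext _ (fun w => ite (fold_right Nat.mul 1 (map (fun g => g w) Gs))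
             (F (map (fun g => g w)
                    ((fun w => hd 0 w) :: map (fun G w => pred (G w)) Gs))) 0)).
    + intros w _; unfold F, Gs; cbn [hd tl map ev]; now rewrite !map_map.
    + apply Rec_ite; [now apply Rec_fold_mul| |rec].
      apply (Rec_comp (S r) F).
      * simpl; rewrite length_map; apply IHf.
      * constructor; [rec|].
        apply Forall_map; eapply Forall_impl; [|exact HGs]; intros G HG; rec.
  - destruct r as [|r].
    + apply (Rec_ext _ (fun _ => 0)); [now intros [|? [|]]|rec].
    + apply (Rec_ext _ (fun w => nat_rect (fun _ => nat) (ev f (hd 0 w) (tl (tl w)))
          (fun n a => ite a (ev g (hd 0 w) (n :: pred a :: tl (tl w))) 0) (hd 0 (tl w)))).
      { now intros [|s [|n v]]. }
      apply (Rec_nat_rect _ (fun w => hd 0 (tl w)) (fun w => ev f (hd 0 w) (tl (tl w)))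
        (fun n a w => ite a (ev g (hd 0 w) (n :: pred a :: tl (tl w))) 0)).
      * rec.
      * apply (Rec_skip r (fun s v => ev f s v)), IHf.
      * apply Rec_ite; [rec| |rec].
        (* The environment is counter, accumulator, bound, recursion argument, then the parameters,
           which therefore start at position 4. *)
        set (Ix := map (fun i w => nth i w 0) (seq 4 r)).
        set (F := fun w => ev g (hd 0 w) (tl w)).
        apply (Rec_ext _ (fun w => F (map (fun g => g w)
          ((fun w => hd 0 (tl (tl w))) :: (fun w => hd 0 w)
            :: (fun w => pred (hd 0 (tl w))) :: Ix)))).
        { intros [|n [|a [|s [|m v]]]] Hv; try discriminate; injection Hv as <-.
          unfold F, Ix; cbn [map hd tl]; rewrite map_map; do 3 f_equal.
          apply (map_nth_seq v [n; a; s; m]). }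
        apply Rec_comp.
        { unfold Ix; simpl; rewrite length_map, length_seq; apply IHg. }
        constructor; [rec|]; constructor; [rec|]; constructor; [rec|].
        apply Forall_map, Forall_forall; intros i Hi; apply in_seq in Hi; rec.
  - assert (Hf : Rec (S (S r)) (fun w => ev f (hd 0 (tl w)) (hd 0 w :: tl (tl w)))).
    { set (Ix := map (fun i w => nth i w 0) (seq 2 r)).
      set (F := fun w => ev f (hd 0 w) (tl w)).
      apply (Rec_ext _ (fun w => F (map (fun g => g w)
        ((fun w => hd 0 (tl w)) :: (fun w => hd 0 w) :: Ix)))).
      { intros [|i [|s v]] Hv; try discriminate; injection Hv as <-.
        unfold F, Ix; cbn [map hd tl]; rewrite map_map; do 2 f_equal.
        apply (map_nth_seq v [i; s]). }
      apply Rec_comp.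
      { unfold Ix; simpl; rewrite length_map, length_seq; apply IHf. }
      constructor; [rec|]; constructor; [rec|].
      apply Forall_map, Forall_forall; intros i Hi; apply in_seq in Hi; rec. }
    set (I := fun w => bmin (hd 0 w) (fun i => lef (ev f (hd 0 w) (i :: tl w)) 1)).
    assert (HI : Rec (S r) I).
    { apply (Rec_bmin _ (fun w => hd 0 w)
        (fun i w => lef (ev f (hd 0 w) (i :: tl w)) 1)); rec. }
    set (V := fun w => ev f (hd 0 w) (I w :: tl w)).
    assert (HV : Rec (S r) V).
    { set (F := fun w => ev f (hd 0 (tl w)) (hd 0 w :: tl (tl w))).
      apply (Rec_ext _ (fun w => F (I w :: map (fun i => nth i w 0) (seq 0 (S r))))).
      - intros w Hw; rewrite <- Hw.
        replace (map _ _) with w; [reflexivity|symmetry; exact (map_nth_seq w [])].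
      - apply Rec_cons_select; [now rewrite length_seq|assumption|].
        intros i Hi; apply in_seq in Hi; lia. }
    change (Rec (S r) (fun w => ite (lef (S (I w)) (hd 0 w) * eqf (V w) 1) (S (I w)) 0)).
    rec.
Qed.

(** One unbounded search over a total test, followed by a total output function; [Mu] looks for a
    zero, so the test is negated as [1 - T]. Here [p] is the program and [y] the condition. *)
Lemma search_machine T O :
  Rec 3 (fun v => T (nth 0 v 0) (nth 1 v 0) (nth 2 v 0)) ->
  Rec 3 (fun v => O (nth 0 v 0) (nth 1 v 0) (nth 2 v 0)) ->
  exists M, forall p y w,
    T w p y <> 0 -> (forall w', w' < w -> T w' p y = 0) -> eval M [p; y] (O w p y).
Proof.
  intros HT [o Ho].
  assert (HT' : Rec 3 (fun v => 1 - T (nth 0 v 0) (nth 1 v 0) (nth 2 v 0))) by rec.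
  destruct HT' as [t Ht].
  exists (Comp o [Mu t; Proj 0; Proj 1]); intros p y w Hw Hmin.
  apply (eval_comp _ _ _ [w; p; y]); [|exact (Ho [w; p; y] eq_refl)].
  constructor; [|repeat constructor].
  apply (eval_mu _ _ _ (fun _ => 0)).
  - intros k Hk; specialize (Ht [k; p; y] eq_refl); cbn [nth] in Ht.
    now rewrite (Hmin k Hk) in Ht.
  - specialize (Ht [w; p; y] eq_refl); cbn [nth] in Ht.
    now replace (1 - T w p y) with 0 in Ht by lia.
Qed.

(** * Strings and numbers *)

(** [S (bits_code x)] is the binary numeral with a leading 1 followed by the digits of [x], least
    significant first. *)
Lemma bits_code_length x : length x = Nat.log2 (S (bits_code x)).
Proof.
  induction x as [|b x IH]; [reflexivity|].
  simpl length; rewrite IH; destruct b.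
  - replace (S (bits_code (true :: x))) with (2 * S (bits_code x) + 1) by (simpl; lia).
    symmetry; apply Nat.log2_succ_double; lia.
  - replace (S (bits_code (false :: x))) with (2 * S (bits_code x)) by (simpl; lia).
    symmetry; apply Nat.log2_double; lia.
Qed.

Lemma bits_code_inj x y : bits_code x = bits_code y -> x = y.
Proof.
  revert y; induction x as [|b x IH]; intros [|b' y]; simpl; try reflexivity;
    try (destruct b; lia); try (destruct b'; lia).
  intros H; assert (b = b') as -> by (destruct b, b'; lia || reflexivity).
  f_equal; apply IH; destruct b'; lia.
Qed.

Lemma bits_code_surj a : exists x, bits_code x = a.
Proof.
  induction a as [a IH] using lt_wf_ind.
  destruct a as [|a]; [now exists []|].
  destruct (IH (a / 2)) as [x Hx]; [pose proof (Nat.div_mod_eq a 2); lia|].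
  exists (Nat.odd a :: x); simpl; rewrite Hx.
  pose proof (Nat.div_mod_eq a 2); pose proof (Nat.bit0_mod a) as Hb.
  rewrite Nat.bit0_odd in Hb; unfold Nat.b2n in Hb; destruct (Nat.odd a); lia.
Qed.

(* The [u]-th string of length [n], with [u] taken modulo [2 ^ n]. *)
Fixpoint str (n u : nat) : bits :=
  match n with 0 => [] | S n' => Nat.odd u :: str n' (u / 2) end.

Lemma str_length n u : length (str n u) = n.
Proof. revert u; induction n; simpl; auto. Qed.

(** The strings of length [n] occupy one block of [2 ^ n] consecutive codes. Indices thus become
    codes by arithmetic, which makes the values on indexed pairs computable. *)
Lemma bits_code_str n u : bits_code (str n u) = 2 ^ n - 1 + u mod 2 ^ n.
Proof.
  revert u; induction n as [|n IH]; intros u; cbn [str bits_code].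
  - now rewrite Nat.mod_1_r.
  - rewrite IH, Nat.pow_succ_r', Nat.Div0.mod_mul_r, <- Nat.bit0_mod, Nat.bit0_odd.
    pose proof (pow2_pos n).
    unfold Nat.b2n; destruct (Nat.odd u); lia.
Qed.

Lemma str_inj n u u' : u < 2 ^ n -> u' < 2 ^ n -> str n u = str n u' -> u = u'.
Proof.
  intros Hu Hu' H; apply (f_equal bits_code) in H.
  rewrite !bits_code_str, !Nat.mod_small in H by assumption; lia.
Qed.

(** * Complexity of elements of recursively enumerable sets *)

Section Enumeration.
Variables E out : nat -> nat.

(** Stage [w] of an enumeration produces [out w] if [E w] is nonzero. Fresh stages are those where
    an element appears for the first time, so that counting them counts elements. *)
Definition fresh (w : nat) : nat :=
  ite (E w) (1 - sum w (fun w' => ite (E w') (eqf (out w') (out w)) 0)) 0.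

Lemma fresh_spec w :
  fresh w <> 0 <-> E w <> 0 /\ forall w', w' < w -> E w' <> 0 -> out w' <> out w.
Proof.
  unfold fresh; destruct (E w) as [|e] eqn:Ew; cbn [ite]; [intuition|].
  split.
  - intros H; split; [lia|]; intros w' Hw' HE Hout.
    assert (H0 : sum w (fun w' => ite (E w') (eqf (out w') (out w)) 0) = 0) by lia.
    rewrite sum_0 in H0; specialize (H0 w' Hw').
    destruct (E w'); [lia|]; cbn [ite] in H0; unfold eqf in H0; lia.
  - intros [_ H]; rewrite (proj2 (sum_0 _ _)); [lia|].
    intros w' Hw'; specialize (H w' Hw'); destruct (E w'); [reflexivity|].
    cbn [ite]; unfold eqf; specialize (H ltac:(lia)); lia.
Qed.

Definition rank (w : nat) : nat := sum w (fun w' => ite (fresh w') 1 0).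

Lemma rank_list b :
  exists l, NoDup l /\ length l = rank b /\
    forall x, In x l -> exists w, w < b /\ E w <> 0 /\ out w = x.
Proof.
  induction b as [|b [l [Hnd [Hlen Hl]]]].
  - exists []; repeat split; [constructor|intros x []].
  - unfold rank in *; simpl; destruct (fresh b) as [|f] eqn:Ef; cbn [ite].
    + exists l; split; [assumption|]; split; [lia|].
      intros x Hx; destruct (Hl x Hx) as [w [? ?]]; exists w; split; [lia|assumption].
    + assert (Hf : fresh b <> 0) by lia; apply fresh_spec in Hf; destruct Hf as [HE Hf].
      exists (out b :: l); split; [|split; [simpl; lia|]].
      * constructor; [|assumption]; intros Hin.
        destruct (Hl _ Hin) as [w [Hw [HEw Hout]]]; now apply (Hf w).
      * intros x [<-|Hx]; [now exists b; split; [lia|]|].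
        destruct (Hl x Hx) as [w [? ?]]; exists w; split; [lia|assumption].
Qed.

Lemma rank_lt w w' : fresh w <> 0 -> w < w' -> rank w < rank w'.
Proof.
  intros Hf Hlt; unfold rank.
  replace w' with (S w + (w' - S w)) by lia; rewrite sum_split; simpl.
  destruct (fresh w); simpl; lia.
Qed.

Lemma fresh_exists w : E w <> 0 -> exists w0, fresh w0 <> 0 /\ out w0 = out w.
Proof.
  intros HE.
  destruct (least_exists (fun w0 => ite (E w0) (eqf (out w0) (out w)) 0) w)
    as [w0 [_ [H0 Hmin]]].
  { destruct (E w); simpl; unfold eqf; lia. }
  assert (H : E w0 <> 0 /\ out w0 = out w).
  { destruct (E w0); simpl in H0; [lia|]; apply eqf_spec in H0; auto. }
  destruct H as [HE0 Hout]; exists w0; split; [|assumption].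
  apply fresh_spec; split; [assumption|]; intros w' Hw' HE' Heq.
  specialize (Hmin w' Hw'); destruct (E w'); [lia|]; simpl in Hmin.
  rewrite Heq, Hout in Hmin; unfold eqf in Hmin; lia.
Qed.

Lemma rank_bound l w :
  (forall w, E w <> 0 -> In (out w) l) -> fresh w <> 0 -> rank w < length l.
Proof.
  intros Hl Hf; pose proof (rank_lt w (S w) Hf ltac:(lia)).
  destruct (rank_list (S w)) as [l' [Hnd [Hlen Hl']]].
  cut (length l' <= length l); [lia|].
  apply NoDup_incl_length; [assumption|].
  intros x Hx; destruct (Hl' x Hx) as [w' [_ [HE <-]]]; auto.
Qed.
End Enumeration.

(* A program [p] is read as the number [S (bits_code p)], whose binary expansion
   has [length p + 1] digits. *)
Definition parse_a (N : nat) : nat := v2 N.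
Definition parse_1 (N : nat) : nat := N / 2 ^ S (v2 N).
Definition parse_b (N : nat) : nat := parse_1 (parse_1 N) mod 2 ^ v2 (parse_1 N).
Definition parse_2 (N : nat) : nat := parse_1 (parse_1 N) / 2 ^ v2 (parse_1 N).
Definition parse_L (N : nat) : nat := Nat.log2 (parse_2 N).
Definition parse_q (N : nat) : nat := parse_2 N - 2 ^ parse_L N.

(** Layout of a program: [a] in unary, the bit length [i] of [b] in unary, the [i] digits of [b],
    and [q] padded to [L] digits behind a marker 1. The value of [L] is read off from the total
    length and costs nothing beyond its digits. *)
Definition description (a b L q : nat) : nat :=
  let i := S (Nat.log2 b) in upair a (upair i (b + 2 ^ i * (2 ^ L + q))).

Lemma lt_pow2_log2 b : b < 2 ^ S (Nat.log2 b).
Proof.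
  destruct b as [|b]; [simpl; lia|].
  apply Nat.log2_spec; lia.
Qed.

Lemma parse_description a b L q (N := description a b L q) :
  q < 2 ^ L ->
  parse_a N = a /\ parse_b N = b /\ parse_L N = L /\ parse_q N = q /\
  Nat.log2 N = a + 2 * Nat.log2 b + 4 + L.
Proof.
  intros Hq; pose proof (lt_pow2_log2 b) as Hb.
  set (i := S (Nat.log2 b)) in *.
  assert (Hlog : Nat.log2 (2 ^ L + q) = L).
  { apply Nat.log2_unique; simpl; lia. }
  set (r := b + 2 ^ i * (2 ^ L + q)).
  assert (E1 : parse_1 N = upair i r).
  { unfold parse_1, N, description; now rewrite v2_upair, upair_div. }
  assert (E2 : parse_1 (parse_1 N) = r).
  { rewrite E1; unfold parse_1; now rewrite v2_upair, upair_div. }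
  assert (E3 : v2 (parse_1 N) = i) by (rewrite E1; apply v2_upair).
  assert (Hr : r mod 2 ^ i = b /\ r / 2 ^ i = 2 ^ L + q).
  { unfold r; rewrite (Nat.mul_comm (2 ^ i)).
    rewrite Nat.Div0.mod_add, Nat.mod_small, Nat.div_add, Nat.div_small by lia; lia. }
  assert (E4 : parse_2 N = 2 ^ L + q) by (unfold parse_2; rewrite E2, E3; apply Hr).
  assert (E5 : parse_L N = L) by (unfold parse_L; now rewrite E4).
  repeat split.
  - unfold parse_a, N, description; apply v2_upair.
  - unfold parse_b; rewrite E2, E3; apply Hr.
  - exact E5.
  - unfold parse_q; rewrite E4, E5; lia.
  - pose proof (pow2_pos L).
    assert (Hr0 : Nat.log2 r = i + L).
    { replace (i + L) with (i + Nat.log2 (2 ^ L + q)) by now rewrite Hlog.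
      unfold r; apply Nat.log2_unique; [lia|].
      destruct (Nat.log2_spec (2 ^ L + q)) as [H1 H2]; [lia|].
      set (e := Nat.log2 (2 ^ L + q)) in *.
      rewrite <- Nat.add_succ_r, !Nat.pow_add_r.
      clearbody e; pose proof (Nat.pow_nonzero 2 i); nia. }
    unfold N, description; fold i; fold r.
    assert (r <> 0) by (unfold r; pose proof (Nat.pow_nonzero 2 i); nia).
    rewrite !log2_upair, Hr0; [unfold i; lia|assumption|].
    unfold upair; pose proof (Nat.pow_nonzero 2 i); nia.
Qed.

Lemma Rec_parse k A : Rec k A ->
  Rec k (fun v => parse_a (A v)) /\ Rec k (fun v => parse_b (A v)) /\
  Rec k (fun v => parse_L (A v)) /\ Rec k (fun v => parse_q (A v)).
Proof.
  intros HA; unfold parse_q, parse_L, parse_a, parse_b, parse_2, parse_1.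
  repeat split; rec.
Qed.

Lemma Ccond_le U x y p : universal U -> run U p y x -> Ccond U x y <= length p.
Proof. intros HU Hp; now apply (proj2 (Ccond_spec U x y HU)). Qed.

(** An element is found from its rank among the distinct elements enumerated, which fits into [L]
    bits. The enumeration may depend on [L] as well: three parameters are available although only
    [a] (in unary) and [b] (in [2 log b] bits) are written down. The list [l] only bounds the number
    of elements. *)
Lemma enumeration_complexity U E out :
  universal U ->
  Rec 5 (fun v => E (nth 0 v 0) (nth 1 v 0) (nth 2 v 0) (nth 3 v 0) (nth 4 v 0)) ->
  Rec 5 (fun v => out (nth 0 v 0) (nth 1 v 0) (nth 2 v 0) (nth 3 v 0) (nth 4 v 0)) ->
  exists c, forall a b L (x y : bits) l w,
    E a b L (bits_code y) w <> 0 ->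
    out a b L (bits_code y) w = bits_code x ->
    (forall w', E a b L (bits_code y) w' <> 0 -> In (out a b L (bits_code y) w') l) ->
    length l <= 2 ^ L ->
    Ccond U x y <= a + 2 * Nat.log2 b + L + c.
Proof.
  intros HU HE Hout.
  set (E' := fun p y => E (parse_a (S p)) (parse_b (S p)) (parse_L (S p)) y).
  set (out' := fun p y => out (parse_a (S p)) (parse_b (S p)) (parse_L (S p)) y).
  assert (Hpar : forall k A, Rec k A ->
    Rec k (fun v => parse_a (S (A v))) /\ Rec k (fun v => parse_b (S (A v))) /\
    Rec k (fun v => parse_L (S (A v))) /\ Rec k (fun v => parse_q (S (A v)))).
  { intros k A HA; apply (Rec_parse k (fun v => S (A v))); rec. }
  assert (HE' : forall k P Y W, Rec k P -> Rec k Y -> Rec k W ->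
    Rec k (fun v => E' (P v) (Y v) (W v))).
  { intros k P Y W HP HY HW; destruct (Hpar k P HP) as [? [? [? ?]]].
    apply (Rec_comp5 k E); assumption. }
  assert (Hout' : forall k P Y W, Rec k P -> Rec k Y -> Rec k W ->
    Rec k (fun v => out' (P v) (Y v) (W v))).
  { intros k P Y W HP HY HW; destruct (Hpar k P HP) as [? [? [? ?]]].
    apply (Rec_comp5 k out); assumption. }
  assert (Hfresh : forall k P Y W, Rec k P -> Rec k Y -> Rec k W ->
    Rec k (fun v => fresh (E' (P v) (Y v)) (out' (P v) (Y v)) (W v))).
  { intros k P Y W HP HY HW; unfold fresh; apply Rec_ite; [auto| |rec].
    apply Rec_sub; [rec|].
    apply (Rec_sum k W (fun w' v => ite (E' (P v) (Y v) w')
      (eqf (out' (P v) (Y v) w') (out' (P v) (Y v) (W v))) 0)); [assumption|].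
    apply Rec_ite; [apply HE'; rec| |rec].
    apply Rec_eqf; apply Hout'; rec. }
  destruct (search_machine
    (fun w p y => ite (fresh (E' p y) (out' p y) w)
                    (eqf (rank (E' p y) (out' p y) w) (parse_q (S p))) 0)
    (fun w p y => out' p y w)) as [M HM].
  { apply Rec_ite; [apply Hfresh; rec| |rec].
    apply Rec_eqf; [|apply (Hpar 3 (fun v => nth 1 v 0)); rec].
    unfold rank.
    apply (Rec_sum 3 (fun v => nth 0 v 0) (fun w' v =>
      ite (fresh (E' (nth 1 v 0) (nth 2 v 0)) (out' (nth 1 v 0) (nth 2 v 0)) w') 1 0));
      [rec|].
    apply Rec_ite; [apply Hfresh; rec|rec|rec]. }
  { apply Hout'; rec. }
  destruct (HU M) as [c Hc]; exists (4 + c).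
  intros a b L x y l w HEw Houtw Hl Hlen.
  destruct (fresh_exists (E a b L (bits_code y)) (out a b L (bits_code y)) w HEw) as [w0 [Hf Hw0]].
  pose proof (rank_bound (E a b L (bits_code y)) (out a b L (bits_code y)) l w0 Hl Hf) as Hrank.
  set (q := rank (E a b L (bits_code y)) (out a b L (bits_code y)) w0) in *.
  destruct (parse_description a b L q) as [Pa [Pb [PL [Pq Plog]]]]; [lia|].
  (* Programs correspond to successors [S (bits_code p)]; the description is positive because its
     logarithm is at least 4. *)
  destruct (description a b L q) as [|p] eqn:Ep; [change (Nat.log2 0) with 0 in Plog; lia|].
  destruct (bits_code_surj p) as [pp Hpp].
  destruct (Hc pp x y) as [pu [Hrun Hpu]].
  { unfold run; rewrite <- Houtw, <- Hw0, Hpp.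
    assert (EE : E' p (bits_code y) = E a b L (bits_code y))
      by (unfold E'; now rewrite Pa, Pb, PL).
    assert (Eo : out' p (bits_code y) = out a b L (bits_code y))
      by (unfold out'; now rewrite Pa, Pb, PL).
    rewrite <- Eo; apply HM; rewrite ?EE, ?Eo, Pq.
    - destruct (fresh _ _ w0); [lia|]; simpl; apply eqf_spec; reflexivity.
    - intros w' Hw'.
      destruct (fresh _ _ w') eqn:Ef; [reflexivity|]; simpl.
      assert (Hlt : rank (E a b L (bits_code y)) (out a b L (bits_code y)) w' < q).
      { apply rank_lt; lia. }
      unfold eqf; lia. }
  apply (Ccond_le U x y pu HU) in Hrun.
  rewrite (bits_code_length pp), Hpp in Hpu; lia.
Qed.

(** * Random pairs *)

Lemma Ccond_le_length U :
  universal U -> exists c, forall x y, Ccond U x y <= length x + c.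
Proof.
  intros HU; destruct (HU (Proj 0)) as [c Hc]; exists c; intros x y.
  destruct (Hc x x y) as [q [Hq Hlen]]; [now constructor|].
  pose proof (Ccond_le U x y q HU Hq); lia.
Qed.

Lemma Ccond_le_C U :
  universal U -> exists c, forall x y, Ccond U x y <= Defs.C U x + c.
Proof.
  intros HU; destruct (HU (Comp U [Proj 0; Zero])) as [c Hc]; exists c; intros x y.
  destruct (Ccond_spec U x [] HU) as [[p [Hp Hlen]] _]; fold (Defs.C U x) in Hlen.
  destruct (Hc p x y) as [q [Hq Hlenq]].
  - apply (eval_comp _ _ _ [bits_code p; 0]); [repeat constructor|exact Hp].
  - pose proof (Ccond_le U x y q HU Hq); lia.
Qed.

(** A relation instead of a function, so that no particular code has to be chosen for each
    element. *)
Lemma length_le_of_injective_relation {A} (R : A -> nat -> Prop) l b :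
  NoDup l ->
  (forall x, In x l -> exists c, c < b /\ R x c) ->
  (forall x x' c, In x l -> In x' l -> R x c -> R x' c -> x = x') ->
  length l <= b.
Proof.
  intros Hnd Hex Hinj.
  assert (H : exists cs, NoDup cs /\ length cs = length l /\
    forall c, In c cs -> c < b /\ exists x, In x l /\ R x c).
  { induction Hnd as [|x l Hx Hnd IH].
    - exists []; repeat split; [constructor|easy..].
    - destruct IH as [cs [Hcs [Hlen Hin]]].
      { intros; apply Hex; now right. }
      { intros x1 x2 c H1 H2; apply Hinj; now right. }
      destruct (Hex x) as [c [Hc HR]]; [now left|].
      exists (c :: cs); split; [|split; [simpl; lia|]].
      + constructor; [|assumption]; intros Hc'.
        destruct (Hin c Hc') as [_ [x' [Hx' HR']]].
        assert (x = x') as -> by (apply (Hinj x x' c); [now left|now right|assumption..]).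
        contradiction.
      + intros c' [<-|Hc']; [split; [assumption|exists x; split; [now left|assumption]]|].
        destruct (Hin c' Hc') as [? [x' [? ?]]]; split; [assumption|].
        exists x'; split; [now right|assumption]. }
  destruct H as [cs [Hcs [<- Hin]]].
  rewrite <- (length_seq b 0); apply NoDup_incl_length; [assumption|].
  intros c Hc; apply in_seq; destruct (Hin c Hc); lia.
Qed.

Lemma sum_b2n_filter b P :
  sum b (fun i => Nat.b2n (P i)) = length (filter P (seq 0 b)).
Proof.
  induction b as [|b IH]; [reflexivity|].
  rewrite seq_S, filter_app, length_app, <- IH; simpl.
  destruct (P b); simpl; lia.
Qed.

Lemma mul_add_inj b q q' r r' :
  r < b -> r' < b -> q * b + r = q' * b + r' -> q = q' /\ r = r'.
Proof.
  intros Hr Hr' H.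
  assert (q = q') by (destruct (Nat.lt_trichotomy q q') as [|[|]]; nia).
  nia.
Qed.

Lemma bits_code_lt p r : length p < r -> bits_code p < 2 ^ r.
Proof.
  intros H; rewrite bits_code_length in H.
  pose proof (lt_pow2_log2 (S (bits_code p))) as Hp.
  assert (2 ^ S (Nat.log2 (S (bits_code p))) <= 2 ^ r)
    by (apply Nat.pow_le_mono_r; lia).
  lia.
Qed.

Lemma run_functional U p y x x' : run U p y x -> run U p y x' -> x = x'.
Proof. intros H H'; apply bits_code_inj; eapply eval_functional; eassumption. Qed.

(* The pairs of strings of length [n] are indexed by [u < 2 ^ n * 2 ^ n]. *)
Definition fst_str (n u : nat) : bits := str n (u / 2 ^ n).
Definition snd_str (n u : nat) : bits := str n (u mod 2 ^ n).

(** A pair violating one of the two bounds is determined by one component, used as condition, and a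
    program shorter than [r] for the other. There are at most [2 * 2 ^ n * 2 ^ r] such codes, fewer
    than the pairs satisfying [P]. *)
Lemma random_pair U n r P :
  universal U ->
  2 * 2 ^ n * 2 ^ r < sum (2 ^ n * 2 ^ n) (fun u => Nat.b2n (P u)) ->
  exists u, u < 2 ^ n * 2 ^ n /\ P u = true /\
    r <= Ccond U (fst_str n u) (snd_str n u) /\
    r <= Ccond U (snd_str n u) (fst_str n u).
Proof.
  intros HU Hsum.
  destruct (Classical_Prop.classic (exists u, u < 2 ^ n * 2 ^ n /\ P u = true /\
    r <= Ccond U (fst_str n u) (snd_str n u) /\
    r <= Ccond U (snd_str n u) (fst_str n u))) as [H|H]; [exact H|exfalso].
  rewrite sum_b2n_filter in Hsum.
  apply (proj1 (Nat.lt_nge _ _) Hsum).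
  (* A code packs the flag [f] telling which component is described, the index of the other
     component, and the program. *)
  set (R := fun u c => u < 2 ^ n * 2 ^ n /\ exists f p,
    c = (f * 2 ^ n + (if f =? 0 then u mod 2 ^ n else u / 2 ^ n)) * 2 ^ r
        + bits_code p /\ bits_code p < 2 ^ r /\
    if f =? 0 then run U p (snd_str n u) (fst_str n u)
    else run U p (fst_str n u) (snd_str n u)).
  pose proof (pow2_pos n) as Hn; pose proof (pow2_pos r) as Hr.
  assert (Hlt : forall u, u < 2 ^ n * 2 ^ n -> u mod 2 ^ n < 2 ^ n /\ u / 2 ^ n < 2 ^ n).
  { intros u Hu; split; [apply Nat.mod_upper_bound; lia|].
    apply Nat.Div0.div_lt_upper_bound; lia. }
  apply (length_le_of_injective_relation R).
  - apply NoDup_filter, seq_NoDup.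
  - intros u Hu; apply filter_In in Hu; destruct Hu as [Hu HP]; apply in_seq in Hu.
    destruct (Hlt u ltac:(lia)).
    assert (Hc : Ccond U (fst_str n u) (snd_str n u) < r \/
                 Ccond U (snd_str n u) (fst_str n u) < r).
    { destruct (Nat.lt_ge_cases (Ccond U (fst_str n u) (snd_str n u)) r); [now left|].
      destruct (Nat.lt_ge_cases (Ccond U (snd_str n u) (fst_str n u)) r); [now right|].
      exfalso; apply H; exists u; repeat split; (assumption || lia). }
    destruct Hc as [Hc|Hc].
    + destruct (Ccond_spec U (fst_str n u) (snd_str n u) HU) as [[p [Hp Hlen]] _].
      pose proof (bits_code_lt p r ltac:(lia)).
      exists (u mod 2 ^ n * 2 ^ r + bits_code p); split; [nia|].
      split; [lia|]; exists 0, p; auto.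
    + destruct (Ccond_spec U (snd_str n u) (fst_str n u) HU) as [[p [Hp Hlen]] _].
      pose proof (bits_code_lt p r ltac:(lia)).
      exists ((1 * 2 ^ n + u / 2 ^ n) * 2 ^ r + bits_code p); split; [nia|].
      split; [lia|]; exists 1, p; auto.
  - intros u u' c _ _ [Hu [f [p [Hc [Hp Hrun]]]]] [Hu' [f' [p' [Hc' [Hp' Hrun']]]]].
    rewrite Hc in Hc'; apply mul_add_inj in Hc'; try assumption.
    destruct Hc' as [Hq Hpp]; apply bits_code_inj in Hpp; subst p'.
    destruct (Hlt u Hu), (Hlt u' Hu').
    apply mul_add_inj in Hq;
      [|now destruct (f =? 0)|now destruct (f' =? 0)].
    destruct Hq as [<- Hv].
    rewrite (Nat.div_mod_eq u (2 ^ n)), (Nat.div_mod_eq u' (2 ^ n)).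
    unfold fst_str, snd_str in *.
    destruct (f =? 0); rewrite <- Hv in Hrun';
      assert (HH := run_functional _ _ _ _ _ Hrun Hrun'); apply str_inj in HH; congruence.
Qed.

(** * Balanced relations *)

Definition bit (a i : nat) : nat := Nat.b2n (Nat.testbit a i).
(** Sets of indices, and likewise relations, are numbers read in binary, so that exhaustive search
    over them is a bounded sum or minimum. *)
Definition mask (b : nat) (P : nat -> bool) : nat := sum b (fun i => Nat.b2n (P i) * 2 ^ i).

Lemma mask_lt b P : mask b P < 2 ^ b.
Proof.
  induction b as [|b IH]; [unfold mask; simpl; lia|].
  unfold mask in *; cbn [sum]; rewrite Nat.pow_succ_r'; destruct (P b); cbn [Nat.b2n]; lia.
Qed.

Lemma testbit_add_pow2 a b i :
  a < 2 ^ b -> Nat.testbit (a + 2 ^ b) i = if i =? b then true else Nat.testbit a i.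
Proof.
  intros Ha; pose proof (pow2_pos b) as Hb.
  rewrite <- (Nat.mul_1_l (2 ^ b)), Nat.add_comm.
  destruct (Nat.lt_ge_cases i b) as [Hi|Hi].
  - rewrite (proj2 (Nat.eqb_neq i b)) by lia.
    rewrite <- (Nat.mod_pow2_bits_low (1 * 2 ^ b + a) b i) by assumption.
    rewrite Nat.add_comm, Nat.Div0.mod_add, Nat.mod_small by assumption; reflexivity.
  - replace i with (i - b + b) at 1 by lia.
    rewrite <- Nat.div_pow2_bits, Nat.div_add_l, Nat.div_small, Nat.add_0_r by lia.
    destruct (Nat.eqb_spec i b) as [->|Hne]; [now rewrite Nat.sub_diag|].
    rewrite (Nat.bits_above_log2 a i).
    + destruct (i - b) as [|d] eqn:E; [lia|].
      apply Nat.bits_above_log2; change (Nat.log2 1) with 0; lia.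
    + destruct a as [|a]; [change (Nat.log2 0) with 0; lia|].
      apply Nat.log2_lt_pow2; [lia|].
      assert (2 ^ b <= 2 ^ i) by (apply Nat.pow_le_mono_r; lia); lia.
Qed.

Lemma testbit_mask b P i : i < b -> Nat.testbit (mask b P) i = P i.
Proof.
  induction b as [|b IH]; [lia|]; intros Hi.
  pose proof (mask_lt b P) as Hlt; unfold mask in *; cbn [sum].
  destruct (P b) eqn:EP; cbn [Nat.b2n].
  - rewrite Nat.mul_1_l, testbit_add_pow2 by assumption.
    destruct (Nat.eqb_spec i b) as [->|]; [now rewrite EP|apply IH; lia].
  - rewrite Nat.mul_0_l, Nat.add_0_r.
    destruct (Nat.eq_dec i b) as [->|]; [|apply IH; lia].
    rewrite EP; destruct (sum b (fun i => Nat.b2n (P i) * 2 ^ i)) as [|a] eqn:E.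
    + apply Nat.bits_0.
    + apply Nat.bits_above_log2, Nat.log2_lt_pow2; lia.
Qed.

Lemma sum_mul_index a b h :
  sum (a * b) h = sum a (fun i => sum b (fun j => h (i * b + j))).
Proof.
  induction a as [|a IH]; [reflexivity|].
  cbn [sum]; rewrite <- IH, Nat.mul_succ_l; apply sum_split.
Qed.

Lemma sum_eqb b c f : c < b -> sum b (fun i => f i * Nat.b2n (c =? i)) = f c.
Proof.
  induction b as [|b IH]; [lia|]; intros Hc; cbn [sum].
  destruct (Nat.eqb_spec c b) as [->|Hne]; cbn [Nat.b2n].
  - rewrite (proj2 (sum_0 b _)); [lia|]; intros i Hi.
    rewrite (proj2 (Nat.eqb_neq b i)) by lia; cbn [Nat.b2n]; lia.
  - rewrite IH; lia.
Qed.

Definition inter (N G B1 B2 : nat) : nat :=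
  sum N (fun i => sum N (fun j => bit B1 i * bit B2 j * bit G (i * N + j))).

Definition popcount (N B : nat) : nat := sum N (bit B).

Definition balanced (N M K G : nat) : Prop :=
  forall B1 B2, B1 < 2 ^ N -> B2 < 2 ^ N ->
    M * inter N G B1 B2 <= 4 * Nat.max (popcount N B1) K * Nat.max (popcount N B2) K.

Open Scope R_scope.

(** * Real sums and the probabilistic construction *)

Fixpoint rsum (b : nat) (f : nat -> R) : R :=
  match b with 0%nat => 0 | S b' => rsum b' f + f b' end.

Definition lsum {A} (l : list A) (f : A -> R) : R := fold_right Rplus 0 (map f l).

Lemma rsum_ext b f g : (forall i, (i < b)%nat -> f i = g i) -> rsum b f = rsum b g.
Proof.
  induction b as [|b IH]; intros H; simpl; [reflexivity|].
  rewrite IH, H by auto; reflexivity.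
Qed.

Lemma rsum_INR b f a : rsum b (fun i => a * INR (f i)) = a * INR (sum b f).
Proof. induction b as [|b IH]; simpl; [|rewrite IH, plus_INR]; lra. Qed.

Lemma lsum_ext {A} (l : list A) f g : (forall x, f x = g x) -> lsum l f = lsum l g.
Proof. intros H; unfold lsum; now rewrite (map_ext _ _ H). Qed.

Lemma lsum_lin {A} (l : list A) f g a b :
  lsum l (fun x => a * f x + b * g x) = a * lsum l f + b * lsum l g.
Proof. unfold lsum; induction l as [|x l IH]; simpl; [|rewrite IH]; lra. Qed.

Lemma lsum_scal {A} (l : list A) f a : lsum l (fun x => a * f x) = a * lsum l f.
Proof. unfold lsum; induction l as [|x l IH]; simpl; [|rewrite IH]; lra. Qed.

Lemma lsum_le {A} (l : list A) f g :
  (forall x, In x l -> f x <= g x) -> lsum l f <= lsum l g.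
Proof.
  unfold lsum; induction l as [|x l IH]; simpl; intros H; [lra|].
  apply Rplus_le_compat; auto.
Qed.

Lemma lsum_ge_term {A} (l : list A) f x :
  (forall x, 0 <= f x) -> In x l -> f x <= lsum l f.
Proof.
  intros Hf; unfold lsum; induction l as [|y l IH]; simpl; [easy|].
  assert (H0 : 0 <= fold_right Rplus 0 (map f l)).
  { clear IH; induction l as [|z l IH]; simpl; [lra|]; pose proof (Hf z); lra. }
  pose proof (Hf y); intros [->|Hx]; [|specialize (IH Hx)]; lra.
Qed.

Lemma lsum_app {A} (l l' : list A) f : lsum (l ++ l') f = lsum l f + lsum l' f.
Proof. unfold lsum; induction l as [|x l IH]; simpl; [|rewrite IH]; lra. Qed.

Lemma lsum_prod {A B} (l : list A) (l' : list B) f g :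
  lsum (list_prod l l') (fun x => f (fst x) * g (snd x)) = lsum l f * lsum l' g.
Proof.
  induction l as [|x l IH]; simpl; [unfold lsum; simpl; lra|].
  rewrite lsum_app, IH; unfold lsum at 1 4; simpl.
  rewrite map_map; simpl; fold (lsum l f).
  enough (fold_right Rplus 0 (map (fun y => f x * g y) l') = f x * lsum l' g) as -> by lra.
  clear; unfold lsum; induction l' as [|y l' IH]; simpl; [|rewrite IH]; lra.
Qed.

(* Each cell is put into [G] independently with probability [q]; the left side
   of the inequality is then at least its mean for some outcome. *)
Lemma averaging {A} (q e : R) (w : nat -> R) (l : list A) (rect : A -> nat -> bool) Q :
  0 <= q <= 1 ->
  forall lam : A -> R, exists G : nat -> bool,
    rsum Q (fun c => if G c then w c else 0)
    - lsum l (fun i => lam i * e ^ sum Q (fun c => Nat.b2n (G c && rect i c)))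
    >= q * rsum Q w
       - lsum l (fun i => lam i * (1 + q * (e - 1)) ^ sum Q (fun c => Nat.b2n (rect i c))).
Proof.
  intros Hq; induction Q as [|Q IH]; intros lam.
  - exists (fun _ => true); simpl; lra.
  (* Putting cell [Q] into the relation multiplies the penalty of each rectangle containing it by
     [e]; the weights [lam] absorb this factor. *)
  - set (lam1 := fun i => if rect i Q then e * lam i else lam i).
    set (E := fun lam => lsum l (fun i => lam i *
                (1 + q * (e - 1)) ^ sum Q (fun c => Nat.b2n (rect i c)))).
    assert (HE : lsum l (fun i => lam i * (1 + q * (e - 1)) ^
                   sum (S Q) (fun c => Nat.b2n (rect i c))) = q * E lam1 + (1 - q) * E lam).
    { unfold E; rewrite <- lsum_lin; apply lsum_ext; intros i; cbn [sum].
      rewrite pow_add; unfold lam1; destruct (rect i Q); cbn [Nat.b2n]; simpl; ring. }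
    rewrite HE; change (rsum (S Q) w) with (rsum Q w + w Q).
    assert (Hext : forall (b : bool) G,
      let G' := fun c => if (c =? Q)%nat then b else G c in
      rsum (S Q) (fun c => if G' c then w c else 0)
        = rsum Q (fun c => if G c then w c else 0) + (if b then w Q else 0) /\
      forall i, sum (S Q) (fun c => Nat.b2n (G' c && rect i c))
        = (sum Q (fun c => Nat.b2n (G c && rect i c)) + Nat.b2n (b && rect i Q))%nat).
    { intros b G G'; split; [|intros i]; cbn [rsum sum]; f_equal.
      - apply rsum_ext; intros c Hc; unfold G'.
        now rewrite (proj2 (Nat.eqb_neq c Q)) by lia.
      - unfold G'; now rewrite Nat.eqb_refl.
      - apply sum_ext; intros c Hc; unfold G'.
        now rewrite (proj2 (Nat.eqb_neq c Q)) by lia.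
      - unfold G'; now rewrite Nat.eqb_refl. }
    (* Conditional expectations: the target is [q] times the guarantee with cell [Q] plus [1 - q]
       times the one without it. If leaving the cell out falls short of this mean, putting it in
       does not. *)
    destruct (Rle_or_lt (q * (rsum Q w + w Q) - (q * E lam1 + (1 - q) * E lam))
                        (q * rsum Q w - E lam)) as [Hle|Hlt].
    + destruct (IH lam) as [G HG]; fold E in HG.
      destruct (Hext false G) as [H1 H2].
      exists (fun c => if (c =? Q)%nat then false else G c).
      rewrite H1.
      rewrite (lsum_ext l _ (fun i => lam i * e ^ sum Q (fun c => Nat.b2n (G c && rect i c)))).
      * unfold E in *; lra.
      * intros i; now rewrite H2, Nat.add_0_r.
    + destruct (IH lam1) as [G HG]; fold E in HG.
      destruct (Hext true G) as [H1 H2].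
      exists (fun c => if (c =? Q)%nat then true else G c).
      rewrite H1.
      rewrite (lsum_ext l _ (fun i => lam1 i * e ^ sum Q (fun c => Nat.b2n (G c && rect i c)))).
      * change (lsum l (fun i => lam1 i * (1 + q * (e - 1)) ^
                  sum Q (fun c => Nat.b2n (rect i c)))) with (E lam1) in HG.
        assert (HD : 0 < w Q - E lam1 + E lam) by nra.
        assert (0 <= (1 - q) * (w Q - E lam1 + E lam)) by (apply Rmult_le_pos; lra).
        lra.
      * intros i; rewrite H2, pow_add; unfold lam1.
        destruct (rect i Q); simpl; ring.
Qed.

Lemma map_add_seq u z v : map (fun s => (u + s)%nat) (seq z v) = seq (u + z) v.
Proof.
  revert z; induction v as [|v IH]; intros z; simpl; [reflexivity|].
  now rewrite IH, Nat.add_succ_r.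
Qed.

(** The binomial theorem as a sum over subsets, by splitting on the top element. *)
Lemma lsum_masks t a :
  lsum (seq 0 (2 ^ t)) (fun B => a ^ popcount t B) = (1 + a) ^ t.
Proof.
  induction t as [|t IH].
  - unfold lsum, popcount; simpl; lra.
  - rewrite Nat.pow_succ_r', Nat.mul_comm.
    replace (2 ^ t * 2)%nat with (2 ^ t + 2 ^ t)%nat by lia.
    rewrite seq_app, lsum_app.
    assert (H : forall s, In s (seq 0 (2 ^ t)) -> popcount (S t) s = popcount t s /\
                popcount (S t) (2 ^ t + s) = S (popcount t s)).
    { intros s Hs; apply in_seq in Hs; unfold popcount; cbn [sum]; unfold bit; split.
      - enough (Nat.testbit s t = false) as -> by (cbn [Nat.b2n]; lia).
        destruct s as [|s]; [apply Nat.bits_0|].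
        apply Nat.bits_above_log2, Nat.log2_lt_pow2; lia.
      - rewrite (Nat.add_comm (2 ^ t) s), testbit_add_pow2, Nat.eqb_refl by lia; cbn [Nat.b2n].
        rewrite (sum_ext t _ (fun i => Nat.b2n (Nat.testbit s i))); [lia|].
        intros i Hi; rewrite testbit_add_pow2 by lia.
        now rewrite (proj2 (Nat.eqb_neq i t)) by lia. }
    assert (H0 : lsum (seq 0 (2 ^ t)) (fun B => a ^ popcount (S t) B) = (1 + a) ^ t).
    { rewrite <- IH; unfold lsum; f_equal; apply map_ext_in.
      intros s Hs; now rewrite (proj1 (H s Hs)). }
    assert (H1 : lsum (seq (0 + 2 ^ t) (2 ^ t)) (fun B => a ^ popcount (S t) B)
                 = a * (1 + a) ^ t).
    { rewrite Nat.add_0_l.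
      replace (seq (2 ^ t) (2 ^ t)) with (map (fun s => (2 ^ t + s)%nat) (seq 0 (2 ^ t))).
      2:{ now rewrite map_add_seq, Nat.add_0_r. }
      rewrite <- IH; unfold lsum; rewrite map_map.
      revert H; generalize (seq 0 (2 ^ t)) as l; induction l as [|s l IHl]; intros H; simpl; [lra|].
      rewrite IHl, (proj2 (H s (or_introl eq_refl))) by (intros; apply H; now right).
      simpl; ring. }
    rewrite H0, H1; simpl; ring.
Qed.

Lemma exp_pow x k : exp x ^ k = exp (INR k * x).
Proof.
  induction k as [|k IH]; [simpl; now rewrite Rmult_0_l, exp_0|].
  rewrite S_INR; simpl; rewrite IH, <- exp_plus; f_equal; ring.
Qed.

Lemma INR_pow2 k : INR (2 ^ k) = 2 ^ k.
Proof. now rewrite pow_INR. Qed.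

Lemma pow2_le_exp k : 2 ^ k <= exp (INR k).
Proof.
  replace (exp (INR k)) with (exp 1 ^ k) by (rewrite exp_pow; f_equal; ring).
  apply pow_incr; pose proof (exp_ineq1_le 1); lra.
Qed.

Lemma exp_le_mono x y : x <= y -> exp x <= exp y.
Proof. intros [Hlt| ->]; [left; now apply exp_increasing|right; reflexivity]. Qed.

Lemma exp_ge_1 x : 0 <= x -> 1 <= exp x.
Proof. intros Hx; pose proof (exp_ineq1_le x); lra. Qed.

(* [X] and [Y] stand for [max b1 K] and [max b2 K]. *)
Lemma rectangle_weight (n M b1 b2 X Y : nat) :
  (1 <= n)%nat -> (1 <= M)%nat -> (b1 <= X)%nat -> (b2 <= Y)%nat ->
  (4 * n * M <= X)%nat -> (4 * n * M <= Y)%nat ->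
  exp (- (4 * INR X * INR Y / INR M)) * (1 + / INR M * (exp 1 - 1)) ^ (b1 * b2)
  <= exp (- INR (16 * n * n * M))
     * (exp (- INR (2 * n)) ^ b1 * exp (- INR (2 * n)) ^ b2).
Proof.
  intros Hn HM Hb1 Hb2 HX HY.
  assert (HMR : 1 <= INR M) by (apply (le_INR 1); lia).
  assert (He : 2 <= exp 1 <= 3) by (pose proof (exp_ineq1_le 1); pose proof exp_le_3; lra).
  (* From [exp 1 - 1 <= 2] and [1 + t <= exp t]. Half of the exponent [4 X Y / M] is consumed here
     and half remains. *)
  assert (Hpow : (1 + / INR M * (exp 1 - 1)) ^ (b1 * b2)
                 <= exp (2 * INR X * INR Y / INR M)).
  { apply Rle_trans with (exp (/ INR M * 2) ^ (b1 * b2)).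
    - assert (0 < / INR M) by (apply Rinv_0_lt_compat; lra).
      apply pow_incr; split; [nra|].
      apply Rle_trans with (1 + / INR M * 2); [nra|apply exp_ineq1_le].
    - rewrite exp_pow.
      replace (2 * INR X * INR Y / INR M) with (INR (X * Y) * (/ INR M * 2))
        by (rewrite mult_INR; field; lra).
      assert (H : INR (b1 * b2) <= INR (X * Y)) by (apply le_INR; nia).
      assert (0 < / INR M) by (apply Rinv_0_lt_compat; lra).
      apply exp_le_mono; nra. }
  apply Rle_trans with (exp (- (4 * INR X * INR Y / INR M)) * exp (2 * INR X * INR Y / INR M)).
  { apply Rmult_le_compat_l; [left; apply exp_pos|exact Hpow]. }
  rewrite !exp_pow, <- !exp_plus.
  (* Each of the two copies of [X * Y] is at least [4 n M] times one side. Half of that gives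
     [8 n^2 M^2], the other half pays for [2 n M b1] or [2 n M b2]. *)
  assert (Hle : ((16 * n * n * M + b1 * (2 * n) + b2 * (2 * n)) * M <= 2 * X * Y)%nat).
  { assert (H1 : (X * (4 * n * M) <= X * Y)%nat) by (apply Nat.mul_le_mono_l; lia).
    assert (H2 : (Y * (4 * n * M) <= Y * X)%nat) by (apply Nat.mul_le_mono_l; lia).
    assert (H3 : (b1 * (2 * n * M) <= X * (2 * n * M))%nat) by (apply Nat.mul_le_mono_r; lia).
    assert (H4 : (b2 * (2 * n * M) <= Y * (2 * n * M))%nat) by (apply Nat.mul_le_mono_r; lia).
    assert (H5 : (4 * n * M * (2 * n * M) <= X * (2 * n * M))%nat)
      by (apply Nat.mul_le_mono_r; lia).
    assert (H6 : (4 * n * M * (2 * n * M) <= Y * (2 * n * M))%nat)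
      by (apply Nat.mul_le_mono_r; lia).
    assert (E1 : ((16 * n * n * M + b1 * (2 * n) + b2 * (2 * n)) * M
      = 4 * n * M * (2 * n * M) + 4 * n * M * (2 * n * M)
        + b1 * (2 * n * M) + b2 * (2 * n * M))%nat) by ring.
    assert (E2 : (X * (4 * n * M) = X * (2 * n * M) + X * (2 * n * M))%nat) by ring.
    assert (E3 : (Y * (4 * n * M) = Y * (2 * n * M) + Y * (2 * n * M))%nat) by ring.
    assert (E4 : (2 * X * Y = X * Y + Y * X)%nat) by ring.
    lia. }
  apply le_INR in Hle; rewrite !mult_INR in Hle; rewrite !plus_INR, !mult_INR in Hle.
  rewrite !mult_INR.
  replace (INR 2) with 2 in * by reflexivity.
  replace (INR 16) with 16 in * by (simpl; lra).
  apply exp_le_mono.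
  assert (Hfin : - (4 * INR X * INR Y / INR M) + 2 * INR X * INR Y / INR M <=
    - (16 * INR n * INR n * INR M)
    + (INR b1 * - (2 * INR n) + INR b2 * - (2 * INR n))).
  { apply (Rmult_le_reg_r (INR M)); [lra|].
    replace ((- (4 * INR X * INR Y / INR M) + 2 * INR X * INR Y / INR M) * INR M)
      with (- (2 * INR X * INR Y)) by (field; lra).
    lra. }
  exact Hfin.
Qed.

Lemma mod_lt_mul i j N : (j < N)%nat -> ((i * N + j) / N = i /\ (i * N + j) mod N = j)%nat.
Proof.
  intros Hj; split.
  - rewrite Nat.div_add_l, Nat.div_small by lia; lia.
  - rewrite Nat.add_comm, Nat.Div0.mod_add; now apply Nat.mod_small.
Qed.

(** Cells are chosen with probability [1 / M]. The averaged quantity is the fraction of related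
    indices, of mean [1 / M], minus the sum over all rectangles of [exp (hits - bound)], of mean at
    most [1 / (2 M)]. An outcome reaching the mean has fraction at least [1 / (2 M)]; as the
    fraction is at most 1, the penalty stays below 1, hence so does each term, and no rectangle
    reaches its bound. *)
Lemma balanced_relation_exists n M (cell : nat -> nat) (N := (2 ^ n * 2 ^ n)%nat) :
  (2 <= n)%nat -> (1 <= M)%nat ->
  (forall u, (u < N)%nat -> (cell u < N * N)%nat) ->
  exists G, (G < 2 ^ (N * N))%nat /\
    (N <= 2 * M * sum N (fun u => bit G (cell u)))%nat /\
    balanced N M (4 * n * M) G.
Proof.
  intros Hn HM Hcell.
  set (K := (4 * n * M)%nat).
  assert (HN : (0 < N)%nat) by (unfold N; pose proof (pow2_pos n); nia).
  assert (HNR : 1 <= INR N) by (apply (le_INR 1); lia).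
  assert (HMR : 1 <= INR M) by (apply (le_INR 1); lia).
  set (l := list_prod (seq 0 (2 ^ N)) (seq 0 (2 ^ N))).
  set (rect := fun (B : nat * nat) c =>
    Nat.testbit (fst B) (c / N) && Nat.testbit (snd B) (c mod N)).
  set (bound := fun B : nat * nat =>
    4 * INR (Nat.max (popcount N (fst B)) K) * INR (Nat.max (popcount N (snd B)) K) / INR M).
  (* Several indices may share a cell, which weighs the fraction of indices mapped to it. *)
  set (w := fun c => / INR N * INR (sum N (fun u => Nat.b2n (cell u =? c)%nat))).
  assert (Hweight : forall f : nat -> bool,
    sum (N * N) (fun c => (Nat.b2n (f c) * sum N (fun u => Nat.b2n (cell u =? c)%nat))%nat)
    = sum N (fun u => Nat.b2n (f (cell u)))).
  { intros f.
    rewrite (sum_ext _ _ (fun c => sum N (fun u => (Nat.b2n (f c) * Nat.b2n (cell u =? c))%nat)))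
      by (intros; now rewrite sum_mul_l).
    rewrite sum_swap; apply sum_ext; intros u Hu.
    apply (sum_eqb _ (cell u) (fun c => Nat.b2n (f c))); auto. }
  assert (HG : forall f : nat -> bool, rsum (N * N) (fun c => if f c then w c else 0)
    = / INR N * INR (sum N (fun u => Nat.b2n (f (cell u))))).
  { intros f; rewrite <- Hweight, <- rsum_INR; apply rsum_ext; intros c _.
    unfold w; destruct (f c); cbn [Nat.b2n]; rewrite ?Nat.mul_1_l, ?Nat.mul_0_l; simpl; ring. }
  assert (Hrect : forall B, sum (N * N) (fun c => Nat.b2n (rect B c))
    = (popcount N (fst B) * popcount N (snd B))%nat).
  { intros B; rewrite sum_mul_index; unfold popcount; rewrite <- sum_mul_r.
    apply sum_ext; intros i Hi; rewrite <- sum_mul_l; apply sum_ext; intros j Hj.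
    unfold rect, bit; destruct (mod_lt_mul i j N Hj) as [-> ->].
    now destruct (Nat.testbit _ i), (Nat.testbit _ j). }
  destruct (averaging (/ INR M) (exp 1) w l rect (N * N)) with (lam := fun B => exp (- bound B))
    as [G HGR].
  { split; [left; apply Rinv_0_lt_compat; lra|].
    rewrite <- Rinv_1; apply Rinv_le_contravar; lra. }
  assert (Hw1 : rsum (N * N) w = 1).
  { specialize (HG (fun _ => true)); simpl in HG.
    rewrite sum_const, Nat.mul_1_r, Rinv_l in HG by lra; exact HG. }
  rewrite Hw1, HG in HGR.
  (* The union over all rectangles is affordable because [N = 2^(2n) <= exp (2n)]: with
     [a = exp (-2n)], each sum over masks is [(1 + a)^N <= 3]. The remaining factor
     [exp (-16 n^2 M)] is at most [1 / (18 M)]. This is why the sides must be at least [4 n M]. *)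
  assert (Heps : lsum l (fun B => exp (- bound B) *
      (1 + / INR M * (exp 1 - 1)) ^ sum (N * N) (fun c => Nat.b2n (rect B c)))
    <= / (2 * INR M)).
  { set (a := exp (- INR (2 * n))).
    apply Rle_trans with (exp (- INR (16 * n * n * M)) * ((1 + a) ^ N * (1 + a) ^ N)).
    - rewrite <- (lsum_masks N a), <- lsum_prod.
      fold l; rewrite <- lsum_scal; apply lsum_le; intros B _.
      rewrite Hrect; eapply Rle_trans.
      { apply (rectangle_weight n M _ _ (Nat.max (popcount N (fst B)) K)
          (Nat.max (popcount N (snd B)) K)); unfold K; lia. }
      fold a; lra.
    - assert (Ha : (1 + a) ^ N <= 3).
      { apply Rle_trans with (exp a ^ N).
        - apply pow_incr; split; [|apply exp_ineq1_le].
          pose proof (exp_pos (- INR (2 * n))); unfold a; lra.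
        - rewrite exp_pow; eapply Rle_trans; [|exact exp_le_3].
          assert (Hle : INR N * a <= 1).
          { unfold a, N; rewrite <- Nat.pow_add_r, INR_pow2.
            replace (n + n)%nat with (2 * n)%nat by lia.
            rewrite exp_Ropp; pose proof (pow2_le_exp (2 * n)).
            pose proof (exp_pos (INR (2 * n))).
            apply (Rmult_le_reg_r (exp (INR (2 * n)))); [assumption|].
            rewrite Rmult_assoc, Rinv_l by lra; lra. }
          now apply exp_le_mono. }
      assert (Ha1 : 1 <= (1 + a) ^ N).
      { apply pow_R1_Rle; pose proof (exp_pos (- INR (2 * n))); unfold a; lra. }
      assert (HE : 18 * INR M <= exp (INR (16 * n * n * M))).
      { pose proof (exp_ineq1_le (INR (16 * n * n * M))).
        assert (H18 : INR (18 * M) <= INR (16 * n * n * M)).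
        { apply le_INR; apply Nat.mul_le_mono_r; nia. }
        rewrite mult_INR in H18; replace (INR 18) with 18 in H18 by (simpl; lra); lra. }
      rewrite exp_Ropp.
      apply Rle_trans with (/ (18 * INR M) * (3 * 3)).
      + apply Rmult_le_compat.
        * left; apply Rinv_0_lt_compat, exp_pos.
        * nra.
        * apply Rinv_le_contravar; lra.
        * apply Rmult_le_compat; lra.
      + right; field; lra. }
  set (S1 := lsum l (fun B => exp (- bound B) *
      exp 1 ^ sum (N * N) (fun c => Nat.b2n (G c && rect B c)))) in HGR.
  assert (Hpos : forall B, 0 <= exp (- bound B) *
      exp 1 ^ sum (N * N) (fun c => Nat.b2n (G c && rect B c))).
  { intros B; rewrite exp_pow, <- exp_plus; left; apply exp_pos. }
  assert (HMinv : / (2 * INR M) < / INR M).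
  { apply Rinv_lt_contravar; nra. }
  assert (H2M : / INR M - / (2 * INR M) = / (2 * INR M)) by (field; lra).
  assert (Hle1 : / INR N * INR (sum N (fun u => Nat.b2n (G (cell u)))) <= 1).
  { apply (Rmult_le_reg_l (INR N)); [lra|].
    rewrite <- Rmult_assoc, Rinv_r, Rmult_1_l, Rmult_1_r by lra.
    apply le_INR; rewrite <- (Nat.mul_1_r N) at 2; rewrite <- sum_const.
    apply sum_le; intros u _; destruct (G (cell u)); cbn [Nat.b2n]; lia. }
  exists (mask (N * N) G); split; [apply mask_lt|split].
  - rewrite (sum_ext N _ (fun u => Nat.b2n (G (cell u))))
      by (intros u Hu; unfold bit; rewrite testbit_mask; auto).
    assert (0 <= S1).
    { unfold S1, lsum; clear - Hpos; induction l as [|B l IH]; simpl; [lra|].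
      pose proof (Hpos B); lra. }
    assert (Hge : / (2 * INR M) <= / INR N * INR (sum N (fun u => Nat.b2n (G (cell u)))))
      by lra.
    apply INR_le; rewrite !mult_INR; change (INR 2) with 2.
    apply (Rmult_le_compat_l (2 * INR M * INR N)) in Hge; [|nra].
    replace (2 * INR M * INR N * / (2 * INR M)) with (INR N) in Hge by (field; lra).
    rewrite <- Rmult_assoc in Hge.
    replace (2 * INR M * INR N * / INR N) with (2 * INR M) in Hge by (field; lra).
    lra.
  - intros B1 B2 HB1 HB2.
    assert (Hin : In (B1, B2) l) by (apply in_prod; apply in_seq; lia).
    assert (Hinter : sum (N * N) (fun c => Nat.b2n (G c && rect (B1, B2) c))
                     = inter N (mask (N * N) G) B1 B2).
    { rewrite sum_mul_index; unfold inter.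
      apply sum_ext; intros i Hi; apply sum_ext; intros j Hj.
      unfold rect, bit; destruct (mod_lt_mul i j N Hj) as [-> ->].
      rewrite testbit_mask by nia; simpl fst; simpl snd.
      now destruct (Nat.testbit B1 i), (Nat.testbit B2 j), (G (i * N + j)%nat). }
    pose proof (lsum_ge_term l _ (B1, B2) Hpos Hin) as Hterm; cbv beta in Hterm.
    fold S1 in Hterm.
    assert (Hlt1 : S1 < 1).
    { assert (0 < / (2 * INR M)) by (apply Rinv_0_lt_compat; lra); lra. }
    rewrite Hinter, exp_pow, <- exp_plus, Rmult_1_r in Hterm.
    set (I := inter N (mask (N * N) G) B1 B2) in *.
    assert (HI : INR I < bound (B1, B2)).
    { destruct (Rlt_or_le (INR I) (bound (B1, B2))) as [|Hge]; [assumption|].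
      pose proof (exp_ge_1 (- bound (B1, B2) + INR I) ltac:(lra)); lra. }
    unfold bound in HI; cbn [fst snd] in HI.
    apply INR_le; rewrite !mult_INR; replace (INR 4) with 4 by (simpl; lra).
    apply (Rmult_lt_compat_l (INR M)) in HI; [|lra].
    set (X := INR (Nat.max (popcount N B1) K)) in *.
    set (Y := INR (Nat.max (popcount N B2) K)) in *.
    replace (INR M * (4 * X * Y / INR M)) with (4 * X * Y) in HI by (field; lra).
    lra.
Qed.

Open Scope nat_scope.

(** * Computability of the balance test *)

Lemma Rec_max k A B : Rec k A -> Rec k B -> Rec k (fun v => Nat.max (A v) (B v)).
Proof.
  intros HA HB; apply (Rec_ext _ (fun v => A v + (B v - A v))); [intros; lia|rec].
Qed.

Lemma Rec_inter k N G B1 B2 : Rec k N -> Rec k G -> Rec k B1 -> Rec k B2 ->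
  Rec k (fun v => inter (N v) (G v) (B1 v) (B2 v)).
Proof. intros; unfold inter; rec. Qed.

Lemma Rec_popcount k N B : Rec k N -> Rec k B -> Rec k (fun v => popcount (N v) (B v)).
Proof.
  intros; apply (Rec_ext _ (fun v => sum (N v) (fun i => bit (B v) i))); [reflexivity|rec].
Qed.

Definition balancedf (N M K G : nat) : nat :=
  1 - sum (2 ^ N) (fun B1 => sum (2 ^ N) (fun B2 =>
    1 - lef (M * inter N G B1 B2)
            (4 * Nat.max (popcount N B1) K * Nat.max (popcount N B2) K))).

Lemma balancedf_spec N M K G : balancedf N M K G <> 0 <-> balanced N M K G.
Proof.
  unfold balancedf, balanced.
  set (t := fun B1 B2 => lef (M * inter N G B1 B2)
    (4 * Nat.max (popcount N B1) K * Nat.max (popcount N B2) K)).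
  change (1 - sum (2 ^ N) (fun B1 => sum (2 ^ N) (fun B2 => 1 - t B1 B2)) <> 0 <->
    forall B1 B2, B1 < 2 ^ N -> B2 < 2 ^ N ->
    M * inter N G B1 B2 <= 4 * Nat.max (popcount N B1) K * Nat.max (popcount N B2) K).
  transitivity (sum (2 ^ N) (fun B1 => sum (2 ^ N) (fun B2 => 1 - t B1 B2)) = 0); [lia|].
  rewrite sum_0; split.
  - intros H B1 B2 H1 H2; specialize (H B1 H1); rewrite sum_0 in H; specialize (H B2 H2).
    apply lef_spec; fold (t B1 B2); lia.
  - intros H B1 H1; apply sum_0; intros B2 H2; specialize (H B1 B2 H1 H2).
    apply lef_spec in H; fold (t B1 B2) in H; lia.
Qed.

Lemma Rec_balancedf k N M K G : Rec k N -> Rec k M -> Rec k K -> Rec k G ->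
  Rec k (fun v => balancedf (N v) (M v) (K v) (G v)).
Proof.
  intros; unfold balancedf.
  repeat (first [apply Rec_inter | apply Rec_popcount | apply Rec_max | rec_step]; cbv beta).
Qed.

Definition pairs (n : nat) : nat := 2 ^ n * 2 ^ n.

Lemma pairs_pos n : 0 < pairs n.
Proof. unfold pairs; pose proof (pow2_pos n); nia. Qed.

Lemma pairs_pow2 n : pairs n = 2 ^ (n + n).
Proof. unfold pairs; now rewrite Nat.pow_add_r. Qed.

Lemma Rec_pairs k A : Rec k A -> Rec k (fun v => pairs (A v)).
Proof. intros; unfold pairs; rec. Qed.

Lemma Rec_div_pairs k A B : Rec k A -> Rec k B -> Rec k (fun v => A v / pairs (B v)).
Proof.
  intros; apply (Rec_ext _ (fun v => A v / 2 ^ (B v + B v))); [|rec].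
  intros; now rewrite pairs_pow2.
Qed.

Lemma Rec_mod_pairs k A B : Rec k A -> Rec k B -> Rec k (fun v => A v mod pairs (B v)).
Proof.
  intros; apply (Rec_ext _ (fun v => A v mod 2 ^ (B v + B v))); [|rec].
  intros; now rewrite pairs_pow2.
Qed.

(** * Values of a computable function on pairs of strings *)

Definition value (f : bits -> bits -> bits) (n u : nat) : bits :=
  f (fst_str n u) (snd_str n u).
Definition vcode (f : bits -> bits -> bits) (n u : nat) : nat := bits_code (value f n u).

Lemma Rec_vcode f : computable f ->
  forall k A B, Rec k A -> Rec k B -> Rec k (fun v => vcode f (A v) (B v)).
Proof.
  intros [M HM] k A B HA HB; apply (Rec_comp2 k (vcode f)); [|assumption..].
  assert (H1 : Rec 2 (fun v => 2 ^ nth 0 v 0 - 1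
    + (nth 1 v 0 / 2 ^ nth 0 v 0) mod 2 ^ nth 0 v 0)) by rec.
  assert (H2 : Rec 2 (fun v => 2 ^ nth 0 v 0 - 1
    + (nth 1 v 0 mod 2 ^ nth 0 v 0) mod 2 ^ nth 0 v 0)) by rec.
  destruct H1 as [c1 H1], H2 as [c2 H2].
  exists (Comp M [c1; c2]); intros v Hv; econstructor.
  - constructor; [exact (H1 v Hv)|]; constructor; [exact (H2 v Hv)|constructor].
  - unfold vcode, value, fst_str, snd_str; rewrite <- !bits_code_str.
    apply HM; now rewrite !str_length.
Qed.

(** Recovers from an output, given as conditioning string, the index that represents it in the
    relation; the value is [pairs n] for strings that are not outputs. *)
Definition index (f : bits -> bits -> bits) (n z : nat) : nat :=
  bmin (pairs n) (fun u => eqf (vcode f n u) z).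

(* Outputs are represented by the first pair producing them, so that the search
   for the relation involves [2 ^ (2 * n)] points whatever the output length. *)
Definition rep (f : bits -> bits -> bits) (n u : nat) : nat := index f n (vcode f n u).

Lemma rep_spec f n u : u < pairs n -> rep f n u < pairs n /\ value f n (rep f n u) = value f n u.
Proof.
  intros Hu.
  destruct (bmin_sat (pairs n) (fun u' => eqf (vcode f n u') (vcode f n u))) as [H1 H2].
  { exists u; split; [assumption|]; now apply eqf_spec. }
  split; [exact H1|]; apply bits_code_inj; now apply eqf_spec in H2.
Qed.

Lemma rep_rep f n u : u < pairs n -> rep f n (rep f n u) = rep f n u.
Proof.
  intros Hu; unfold rep at 1; unfold vcode; now rewrite (proj2 (rep_spec f n u Hu)).
Qed.

(** * The relation on outputs and the descriptions it yields *)

Section Core.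
Variable U : prog.
Hypothesis HU : universal U.
Variables f1 f2 : bits -> bits -> bits.
Hypothesis Hf1 : computable f1.
Hypothesis Hf2 : computable f2.

Lemma Rec_index f : computable f ->
  forall k A B, Rec k A -> Rec k B -> Rec k (fun v => index f (A v) (B v)).
Proof.
  intros Hf k A B HA HB; unfold index, pairs; rec_step; [rec|].
  apply Rec_eqf; [apply Rec_vcode; [assumption|rec..]|rec].
Qed.

Lemma Rec_rep f : computable f ->
  forall k A B, Rec k A -> Rec k B -> Rec k (fun v => rep f (A v) (B v)).
Proof. intros; unfold rep; apply Rec_index; [assumption..|]; now apply Rec_vcode. Qed.

Definition cell (n u : nat) : nat := rep f1 n u * pairs n + rep f2 n u.

(** Taking the first suitable number makes the relation a function computable from [n] and [m], so a
    description need not contain it. *)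
Definition relation (n m : nat) : nat :=
  bmin (2 ^ (pairs n * pairs n)) (fun G =>
    lef (pairs n) (2 * 2 ^ m * sum (pairs n) (fun u => bit G (cell n u)))
    * balancedf (pairs n) (2 ^ m) (4 * n * 2 ^ m) G).

Lemma relation_spec n m : 2 <= n ->
  pairs n <= 2 * 2 ^ m * sum (pairs n) (fun u => bit (relation n m) (cell n u)) /\
  balanced (pairs n) (2 ^ m) (4 * n * 2 ^ m) (relation n m).
Proof.
  intros Hn.
  destruct (balanced_relation_exists n (2 ^ m) (cell n)) as [G [HG [Hbig Hbal]]].
  - assumption.
  - pose proof (pow2_pos m); lia.
  - intros u Hu; fold (pairs n) in *; unfold cell.
    pose proof (rep_spec f1 n u Hu); pose proof (rep_spec f2 n u Hu); nia.
  - fold (pairs n) in *.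
    destruct (bmin_sat (2 ^ (pairs n * pairs n)) (fun G =>
      lef (pairs n) (2 * 2 ^ m * sum (pairs n) (fun u => bit G (cell n u)))
      * balancedf (pairs n) (2 ^ m) (4 * n * 2 ^ m) G)) as [_ H].
    + exists G; split; [assumption|].
      apply lef_spec in Hbig; apply balancedf_spec in Hbal; nia.
    + fold (relation n m) in H; apply Nat.neq_mul_0 in H; destruct H as [H1 H2].
      split; [now apply lef_spec in H1|now apply balancedf_spec in H2].
Qed.

Lemma Rec_relation k A B : Rec k A -> Rec k B -> Rec k (fun v => relation (A v) (B v)).
Proof.
  intros HA HB; unfold relation, cell; rec_step.
  - unfold pairs; rec.
  - repeat (first [apply Rec_balancedf | apply Rec_rep; [assumption|..] | apply Rec_pairs
                  | rec_step]; cbv beta).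
Qed.

(* Within [s] steps some program of length at most [k] outputs the string
   coded by [z]; a code is below [2 ^ (k + 1) - 1] iff the length is at most
   [k]. *)
Definition simple (s k z : nat) : nat :=
  sum (2 ^ S k - 1) (fun p => eqf (ev U s [p; 0]) (S z)).

Lemma simple_sound s k x : simple s k (bits_code x) <> 0 -> Defs.C U x <= k.
Proof.
  intros H; apply sum_nonzero in H; destruct H as [p [Hp H]].
  apply eqf_spec, ev_sound in H.
  destruct (bits_code_surj p) as [q <-].
  apply Nat.le_trans with (length q); [now apply Ccond_le|].
  rewrite bits_code_length; apply Nat.lt_succ_r, Nat.log2_lt_pow2; lia.
Qed.

Lemma simple_complete k x : Defs.C U x <= k -> 
  exists s0, forall s, s0 <= s -> simple s k (bits_code x) <> 0.
Proof.
  intros H; destruct (Ccond_spec U x [] HU) as [[p [Hp Hlen]] _].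
  fold (Defs.C U x) in Hlen.
  destruct (ev_complete _ _ _ Hp) as [s0 Hs]; exists s0; intros s Hle.
  apply sum_nonzero; exists (bits_code p); split.
  - rewrite bits_code_length in Hlen.
    pose proof (lt_pow2_log2 (S (bits_code p))).
    assert (2 ^ S (Nat.log2 (S (bits_code p))) <= 2 ^ S k)
      by (apply Nat.pow_le_mono_r; lia).
    lia.
  - apply eqf_spec, Hs, Hle.
Qed.

Lemma Rec_simple k A B D : Rec k A -> Rec k B -> Rec k D ->
  Rec k (fun v => simple (A v) (B v) (D v)).
Proof.
  intros HA HB HD; unfold simple; rec_step; [rec|].
  apply Rec_eqf; [|rec].
  apply (Rec_comp (S k) (fun w => ev U (hd 0 w) (tl w))
    [(fun w => A (tl w)); (fun w => hd 0 w); (fun _ => 0)]); [apply Rec_ev|].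
  repeat constructor; rec.
Qed.

(** [lam j] is the exact binary logarithm of the length [dim j], and [j] is its triple logarithm,
    short enough to be written in unary. *)
Definition lam (j : nat) : nat := 2 ^ 2 ^ j.
Definition dim (j : nat) : nat := 2 ^ lam j.

Lemma Rec_lam k A : Rec k A -> Rec k (fun v => lam (A v)).
Proof. intros; unfold lam; rec. Qed.

Lemma Rec_dim k A : Rec k A -> Rec k (fun v => dim (A v)).
Proof. intros; unfold dim, lam; rec. Qed.

Ltac rec_core :=
  cbv beta; repeat (first [apply Rec_relation | apply Rec_simple
    | apply Rec_rep; [assumption|..] | apply Rec_index; [assumption|..]
    | apply Rec_vcode; [assumption|..] | apply Rec_pairs
    | apply Rec_div_pairs | apply Rec_mod_pairs | apply Rec_dim | apply Rec_lam
    | rec_step]; cbv beta).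

(** Restricting to representatives leaves one index per output, so that counting indices counts
    strings. *)
Definition lowb (n k i : nat) : bool :=
  ((rep f1 n i =? i) && (Defs.C U (value f1 n i) <=? k))%nat.

Definition row (n m k i2 : nat) : nat :=
  sum (pairs n) (fun i => Nat.b2n (lowb n k i && Nat.testbit (relation n m) (i * pairs n + i2))).

(** The threshold is the permitted density [4 * 2^-m] times [2^(k+1)], the bound on the number of
    strings of complexity at most [k]. *)
Definition heavy (n m k i2 : nat) : bool :=
  ((rep f2 n i2 =? i2) && (2 ^ (k + 3 - m) <? row n m k i2))%nat.

Lemma low_count n k : sum (pairs n) (fun i => Nat.b2n (lowb n k i)) <= 2 ^ S k.
Proof.
  rewrite sum_b2n_filter.
  apply (length_le_of_injective_relation (fun i c => exists p,
    c = bits_code p /\ run U p [] (value f1 n i))).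
  - apply NoDup_filter, seq_NoDup.
  - intros i Hi; apply filter_In in Hi; destruct Hi as [_ Hi].
    apply andb_prop in Hi; destruct Hi as [_ Hi]; apply Nat.leb_le in Hi.
    destruct (Ccond_spec U (value f1 n i) [] HU) as [[p [Hp Hlen]] _].
    exists (bits_code p); split; [|now exists p].
    apply bits_code_lt; unfold Defs.C in Hi; lia.
  - intros i i' c Hi Hi' [p [-> Hp]] [p' [E Hp']].
    apply bits_code_inj in E; subst p'.
    assert (Hv := run_functional _ _ _ _ _ Hp Hp').
    apply filter_In, proj2, andb_prop, proj1, Nat.eqb_eq in Hi, Hi'.
    rewrite <- Hi, <- Hi'; unfold rep, vcode; now rewrite Hv.
Qed.

(** With more than [K] heavy outputs, the rectangle of low and heavy ones would hold more than
    [2^(k+3-m)] related pairs per heavy output, above the permitted density. Since [K <= 2^(k+1)],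
    clamping the low side does no harm. *)
Lemma heavy_count n m k : 2 <= n -> 4 * n * 2 ^ m <= 2 ^ S k -> m <= k ->
  sum (pairs n) (fun i => Nat.b2n (heavy n m k i)) <= 4 * n * 2 ^ m.
Proof.
  intros Hn HK Hmk; set (K := 4 * n * 2 ^ m) in *.
  destruct (Nat.le_gt_cases (sum (pairs n) (fun i => Nat.b2n (heavy n m k i))) K)
    as [|Hgt]; [assumption|exfalso].
  destruct (relation_spec n m Hn) as [_ Hbal]; fold K in Hbal.
  set (N := pairs n) in *; set (G := relation n m) in *.
  specialize (Hbal (mask N (lowb n k)) (mask N (heavy n m k)) (mask_lt _ _) (mask_lt _ _)).
  assert (Hpop : forall P, popcount N (mask N P) = sum N (fun i => Nat.b2n (P i))).
  { intros P; apply sum_ext; intros i Hi; unfold bit; now rewrite testbit_mask. }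
  rewrite !Hpop in Hbal; pose proof (low_count n k) as Hlow; fold N in Hlow.
  set (h := sum N (fun i => Nat.b2n (heavy n m k i))) in *.
  assert (Hint : h * S (2 ^ (k + 3 - m)) <= inter N G (mask N (lowb n k)) (mask N (heavy n m k))).
  { unfold inter; rewrite sum_swap; unfold h; rewrite <- sum_mul_r.
    apply sum_le; intros i2 Hi2.
    rewrite (sum_ext N _ (fun i => Nat.b2n (heavy n m k i2) *
      Nat.b2n (lowb n k i && Nat.testbit G (i * N + i2)))).
    - rewrite sum_mul_l; fold (row n m k i2).
      destruct (heavy n m k i2) eqn:E; cbn [Nat.b2n]; [|lia].
      apply andb_prop, proj2, Nat.ltb_lt in E; change (sum N _) with (row n m k i2); lia.
    - intros i Hi; unfold bit; rewrite !testbit_mask by assumption.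
      now destruct (lowb n k i), (heavy n m k i2), (Nat.testbit G (i * N + i2)). }
  assert (Hpow : 2 ^ m * 2 ^ (k + 3 - m) = 4 * 2 ^ S k).
  { rewrite <- Nat.pow_add_r; replace (m + (k + 3 - m)) with (2 + S k) by lia.
    now rewrite Nat.pow_add_r. }
  rewrite (Nat.max_l h K) in Hbal by lia.
  assert (Hmax : Nat.max (sum N (fun i => Nat.b2n (lowb n k i))) K <= 2 ^ S k) by lia.
  pose proof (pow2_pos m).
  assert (H1 : 2 ^ m * (h * S (2 ^ (k + 3 - m))) <= 4 * 2 ^ S k * h).
  { eapply Nat.le_trans; [apply Nat.mul_le_mono_l, Hint|].
    eapply Nat.le_trans; [exact Hbal|].
    apply Nat.mul_le_mono_r, Nat.mul_le_mono_l, Hmax. }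
  rewrite <- Hpow in H1; nia.
Qed.

(** A stage [w] codes a time bound [s] and a candidate [i]. With [L = k + 3 - m], the complexity
    bound [k] is recovered as [L + m - 3], so only [j] and [m] are written down. *)
Definition light_enum (j m L y w : nat) : nat :=
  let n := dim j in let i := w mod pairs n in let s := w / pairs n in
  eqf (rep f1 n i) i * simple s (L + m - 3) (vcode f1 n i)
  * bit (relation n m) (i * pairs n + index f2 n y).

(** Here [2^L = 4 n 2^m] bounds the number of heavy outputs, so [m] is recovered from [L], and [j]
    and [k] are written down. At every stage the strings known to be simple are among the truly
    simple ones; a row found too long is therefore really too long. *)
Definition heavy_enum (j k L y w : nat) : nat :=
  let n := dim j in let i := w mod pairs n in let s := w / pairs n in
  let m := L - lam j - 2 in
  eqf (rep f2 n i) i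
  * lef (S (2 ^ (k + 3 - m)))
      (sum (pairs n) (fun i1 => ite (eqf (rep f1 n i1) i1 * simple s k (vcode f1 n i1)) 1 0
                                * bit (relation n m) (i1 * pairs n + i))).

Lemma mul_nonzero a b : a * b <> 0 <-> a <> 0 /\ b <> 0.
Proof. nia. Qed.

Lemma bit_nonzero a i : bit a i <> 0 <-> Nat.testbit a i = true.
Proof. unfold bit; destruct (Nat.testbit a i); simpl; intuition lia. Qed.

Lemma index_of_value f n u : index f n (bits_code (value f n u)) = rep f n u.
Proof. reflexivity. Qed.

Lemma light_complexity : exists c, forall j m k u, let n := dim j in
  u < pairs n -> Nat.testbit (relation n m) (cell n u) = true ->
  Defs.C U (value f1 n u) = k -> m <= k ->
  heavy n m k (rep f2 n u) = false ->
  Ccond U (value f1 n u) (value f2 n u) <= j + 2 * Nat.log2 m + (k + 3 - m) + c.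
Proof.
  destruct (enumeration_complexity U light_enum
    (fun j m L y w => vcode f1 (dim j) (w mod pairs (dim j))) HU) as [c Hc].
  { unfold light_enum; rec_core. }
  { rec_core. }
  exists c; intros j m k u n Hu Hrel Hk Hmk Hlight.
  pose proof (pairs_pos n) as HN.
  destruct (rep_spec f1 n u Hu) as [Hr1 Hv1]; destruct (rep_spec f2 n u Hu) as [Hr2 Hv2].
  destruct (simple_complete k (value f1 n u)) as [s Hs]; [lia|].
  assert (Hw : (s * pairs n + rep f1 n u) mod pairs n = rep f1 n u /\
               (s * pairs n + rep f1 n u) / pairs n = s)
    by (destruct (mod_lt_mul s (rep f1 n u) (pairs n) Hr1); auto).
  destruct Hw as [Hw1 Hw2].
  apply (Hc j m (k + 3 - m) (value f1 n u) (value f2 n u)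
    (map (vcode f1 n) (filter (fun i => lowb n k i &&
       Nat.testbit (relation n m) (i * pairs n + rep f2 n u)) (seq 0 (pairs n))))
    (s * pairs n + rep f1 n u)).
  - unfold light_enum; fold n; cbv zeta; rewrite Hw1, Hw2, index_of_value.
    replace (k + 3 - m + m - 3) with k by lia.
    rewrite !mul_nonzero; repeat split.
    + apply eqf_spec; now apply rep_rep.
    + unfold vcode; rewrite Hv1; apply Hs; lia.
    + now apply bit_nonzero.
  - fold n; rewrite Hw1; unfold vcode; now rewrite Hv1.
  - intros w; unfold light_enum; fold n; cbv zeta; rewrite index_of_value.
    replace (k + 3 - m + m - 3) with k by lia.
    rewrite !mul_nonzero; intros [[H1 H2] H3].
    apply in_map, filter_In; split.
    + apply in_seq; pose proof (Nat.mod_upper_bound w (pairs n)); lia.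
    + apply eqf_spec, Nat.eqb_eq in H1; apply bit_nonzero in H3.
      apply simple_sound, Nat.leb_le in H2.
      unfold lowb; now rewrite H1, H2, H3.
  - rewrite length_map, <- sum_b2n_filter.
    unfold heavy in Hlight; rewrite rep_rep, Nat.eqb_refl in Hlight by assumption.
    apply Nat.ltb_ge in Hlight; exact Hlight.
Qed.

Lemma heavy_complexity : exists c, forall j m k u, let n := dim j in
  u < pairs n -> m <= k -> m + lam j + 2 <= S k ->
  heavy n m k (rep f2 n u) = true ->
  Defs.C U (value f2 n u) <= j + 2 * Nat.log2 k + (m + lam j + 2) + c.
Proof.
  destruct (enumeration_complexity U heavy_enum
    (fun j m L y w => vcode f2 (dim j) (w mod pairs (dim j))) HU) as [c Hc].
  { unfold heavy_enum; rec_core. }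
  { rec_core. }
  exists c; intros j m k u n Hu Hmk HK Hheavy.
  pose proof (pairs_pos n) as HN.
  destruct (rep_spec f2 n u Hu) as [Hr2 Hv2].
  assert (HKn : 4 * n * 2 ^ m = 2 ^ (m + lam j + 2)).
  { rewrite !Nat.pow_add_r; unfold n, dim; change (2 ^ 2) with 4; ring. }
  assert (Hn : 2 <= n).
  { unfold n, dim, lam; apply (Nat.pow_le_mono_r 2 1); [lia|].
    pose proof (pow2_pos (2 ^ j)); lia. }
  (* One stage late enough to recognise all outputs of [f1] of complexity at most [k], so that the
     row of the given output is counted in full. *)
  destruct (finite_uniform (pairs n) (fun i s => Defs.C U (value f1 n i) <= k ->
    simple s k (vcode f1 n i) <> 0)) as [s Hs].
  { intros i _; destruct (Nat.le_gt_cases (Defs.C U (value f1 n i)) k) as [H|H].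
    - destruct (simple_complete k _ H) as [s Hs]; exists s; auto.
    - exists 0; lia. }
  specialize (Hs s (le_n s)).
  assert (Hw : (s * pairs n + rep f2 n u) mod pairs n = rep f2 n u /\
               (s * pairs n + rep f2 n u) / pairs n = s)
    by (destruct (mod_lt_mul s (rep f2 n u) (pairs n) Hr2); auto).
  destruct Hw as [Hw1 Hw2].
  apply (Hc j k (m + lam j + 2) (value f2 n u) []
    (map (vcode f2 n) (filter (heavy n m k) (seq 0 (pairs n))))
    (s * pairs n + rep f2 n u)).
  - unfold heavy_enum; fold n; cbv zeta; rewrite Hw1, Hw2.
    replace (m + lam j + 2 - lam j - 2) with m by lia.
    apply mul_nonzero; split.
    + apply eqf_spec; now apply rep_rep.
    + apply lef_spec; apply andb_prop, proj2, Nat.ltb_lt in Hheavy.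
      eapply Nat.le_trans; [exact Hheavy|]; apply sum_le; intros i Hi.
      destruct (lowb n k i) eqn:E; cbn [andb Nat.b2n]; [|lia].
      apply andb_prop in E; destruct E as [E1 E2].
      apply Nat.eqb_eq, eqf_spec in E1; apply Nat.leb_le, (Hs i Hi) in E2.
      destruct (eqf (rep f1 n i) i * simple s k (vcode f1 n i)) eqn:E; [nia|].
      cbn [ite]; unfold bit; lia.
  - fold n; rewrite Hw1; unfold vcode; now rewrite Hv2.
  - intros w; unfold heavy_enum; fold n; cbv zeta.
    replace (m + lam j + 2 - lam j - 2) with m by lia.
    rewrite !mul_nonzero; intros [H1 H2].
    apply in_map, filter_In; split.
    + apply in_seq; pose proof (Nat.mod_upper_bound w (pairs n)); lia.
    + apply eqf_spec, Nat.eqb_eq in H1; apply lef_spec in H2.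
      unfold heavy; rewrite H1; apply Nat.ltb_lt.
      eapply Nat.le_trans; [exact H2|]; apply sum_le; intros i Hi.
      destruct (eqf (rep f1 n i) i * simple (w / pairs n) k (vcode f1 n i)) eqn:E;
        cbn [ite]; [lia|].
      assert (H : eqf (rep f1 n i) i <> 0 /\ simple (w / pairs n) k (vcode f1 n i) <> 0)
        by (apply mul_nonzero; lia).
      destruct H as [E1 E2]; apply eqf_spec, Nat.eqb_eq in E1.
      apply simple_sound, Nat.leb_le in E2; unfold lowb; rewrite E1, E2.
      cbn [andb]; unfold bit; lia.
  - rewrite length_map, <- sum_b2n_filter, <- HKn.
    apply heavy_count; [assumption| |assumption].
    rewrite HKn; apply Nat.pow_le_mono_r; lia.
Qed.

(** An output is determined by its rank among at most [2^(2n)] outputs. This bounds [log k] by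
    [log n + 2] whatever the output length is. *)
Lemma value_complexity : exists c, forall j u, u < pairs (dim j) ->
  Defs.C U (value f1 (dim j) u) <= j + (dim j + dim j) + c.
Proof.
  destruct (enumeration_complexity U (fun _ _ _ _ _ => 1)
    (fun j m L y w => vcode f1 (dim j) (w mod pairs (dim j))) HU) as [c Hc].
  { rec_core. }
  { rec_core. }
  exists c; intros j u Hu; set (n := dim j) in *.
  specialize (Hc j 0 (n + n) (value f1 n u) [] (map (vcode f1 n) (seq 0 (pairs n))) u).
  fold n in Hc; change (2 * Nat.log2 0) with 0 in Hc; rewrite Nat.add_0_r in Hc.
  apply Hc.
  - lia.
  - rewrite Nat.mod_small by assumption; reflexivity.
  - intros w _; apply in_map, in_seq.
    pose proof (Nat.mod_upper_bound w (pairs n)); pose proof (pairs_pos n); lia.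
  - rewrite length_map, length_seq, pairs_pow2; lia.
Qed.
End Core.

Open Scope R_scope.

(** * Logarithms and the final estimate *)

Lemma log2_pow2 k : log2 (INR (2 ^ k)) = INR k.
Proof.
  unfold log2; rewrite INR_pow2, <- (Rpower_pow k 2) by lra.
  unfold Rpower; rewrite ln_exp; field.
  pose proof ln_lt_2; lra.
Qed.

Lemma log2_le x y : 0 < x -> x <= y -> log2 x <= log2 y.
Proof.
  intros Hx [Hlt| ->]; [|lra]; unfold log2.
  apply Rmult_le_compat_r; [pose proof ln_lt_2; left; apply Rinv_0_lt_compat; lra|].
  left; now apply ln_increasing.
Qed.

Lemma log2_nonneg x : 1 <= x -> 0 <= log2 x.
Proof.
  intros Hx; replace 0 with (log2 (INR (2 ^ 0))) by apply log2_pow2.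
  apply log2_le; simpl; lra.
Qed.

Lemma nat_log2_le x m : 1 <= x -> INR m <= x -> INR (Nat.log2 m) <= log2 x.
Proof.
  intros Hx Hm; destruct m as [|m]; [now apply log2_nonneg|].
  rewrite <- log2_pow2; apply log2_le; [apply lt_0_INR, pow2_pos|].
  apply Rle_trans with (INR (S m)); [|assumption].
  apply le_INR, Nat.log2_spec; lia.
Qed.

Lemma nat_floor x : 0 <= x -> exists m, INR m <= x < INR m + 1.
Proof.
  intros Hx; destruct (archimed x) as [H1 H2].
  assert (H0 : (0 < up x)%Z) by (apply lt_IZR; lra).
  exists (Z.to_nat (up x - 1)).
  rewrite INR_IZR_INZ, Z2Nat.id, minus_IZR by lia; lra.
Qed.

(** With [r = n - m - 3] at most [2^(2n-m-2)] pairs are not random, half of the guaranteed number of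
    pairs in [P]. The dependency bound then follows from [C(x) <= n + c1], and the lower bounds on
    complexity from [C(x|y) <= C(x) + c2]. *)
Lemma random_pair_dep U c1 c2 n m P :
  universal U ->
  (forall x y, (Ccond U x y <= length x + c1)%nat) ->
  (forall x y, (Ccond U x y <= Defs.C U x + c2)%nat) ->
  (m + 3 <= n)%nat ->
  (pairs n <= 2 * 2 ^ m * sum (pairs n) (fun u => Nat.b2n (P u)))%nat ->
  exists u, (u < pairs n)%nat /\ P u = true /\
    dep U (fst_str n u) (snd_str n u) <= INR (m + 3 + c1) /\
    (n <= Defs.C U (fst_str n u) + (m + 3 + c2))%nat /\
    (n <= Defs.C U (snd_str n u) + (m + 3 + c2))%nat.
Proof.
  intros HU Hc1 Hc2 Hm Hsum.
  destruct (random_pair U n (n - m - 3) P HU) as [u [Hu [HP [Hxy Hyx]]]].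
  - fold (pairs n).
    assert (E : (2 * 2 ^ n * 2 ^ (n - m - 3) * (2 * (2 * 2 ^ m)) = pairs n)%nat).
    { replace (2 ^ n * 2 ^ n)%nat with (pairs n) by reflexivity.
      rewrite pairs_pow2.
      transitivity (2 ^ (1 + n + (n - m - 3) + 2 + m))%nat.
      - rewrite !Nat.pow_add_r; simpl; ring.
      - f_equal; lia. }
    pose proof (pairs_pos n); pose proof (pow2_pos m); nia.
  - exists u; repeat split; [assumption..| | |].
    + pose proof (Hc1 (fst_str n u) []) as Hx; pose proof (Hc1 (snd_str n u) []) as Hy.
      fold (Defs.C U (fst_str n u)) in Hx; fold (Defs.C U (snd_str n u)) in Hy.
      assert (Lx : length (fst_str n u) = n) by apply str_length.
      assert (Ly : length (snd_str n u) = n) by apply str_length.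
      rewrite Lx in Hx; rewrite Ly in Hy.
      assert (Ex : (Defs.C U (fst_str n u) <= Ccond U (fst_str n u) (snd_str n u)
                     + (m + 3 + c1))%nat) by lia.
      assert (Ey : (Defs.C U (snd_str n u) <= Ccond U (snd_str n u) (fst_str n u)
                     + (m + 3 + c1))%nat) by lia.
      apply le_INR in Ex, Ey; rewrite plus_INR in Ex, Ey.
      unfold dep; apply Rmax_lub; lra.
    + pose proof (Hc2 (fst_str n u) (snd_str n u)); lia.
    + pose proof (Hc2 (snd_str n u) (fst_str n u)); lia.
Qed.

Theorem theorem5 :
  forall U : prog, universal U ->
  exists c0 : R,
  forall (alpha beta s : nat -> R) (l : nat -> nat),
    for_large (fun n => c0 <= alpha n) ->
    for_large (fun n => alpha n <= INR n / 2 - 5 * log2 (INR n)) ->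
    for_large (fun n => beta n = alpha n - log2 (INR n) - 3 * log2 (alpha n)) ->
    for_large (fun n => s n <= INR n - alpha n - 2 * log2 (INR n) - c0) ->
    for_large (fun n => beta n + 8 * log2 (INR n) <= INR (l n)) ->
    ~ exists f1 f2 : bits -> bits -> bits,
        computable f1 /\ computable f2 /\
        dependency_reduction U alpha beta s l 8 f1 f2.
Proof.
  intros U HU.
  destruct (Ccond_le_length U HU) as [c1 Hc1].
  destruct (Ccond_le_C U HU) as [c2 Hc2].
  (* [c0] precedes [f1] and [f2], so only constants of [U] may enter; [cl], [ch] and [cv] are
     absorbed later by a large [j]. *)
  exists (INR (c1 + c2 + 4)).
  intros alpha beta s l [N1 H1] [N2 H2] [N3 H3] [N4 H4] _ [f1 [f2 [Hf1 [Hf2 [_ [_ Hred]]]]]].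
  destruct (light_complexity U HU f1 f2 Hf1 Hf2) as [cl Hlight].
  destruct (heavy_complexity U HU f1 f2 Hf1 Hf2) as [ch Hheavy].
  destruct (value_complexity U HU f1 Hf1) as [cv Hvalue].
  set (J := (N1 + N2 + N3 + N4 + c1 + c2 + cl + ch + cv + 10)%nat).
  set (j := S (S J)); set (n := dim j).
  assert (Hj : (4 * J + 4 <= 2 ^ j)%nat).
  { unfold j; rewrite !Nat.pow_succ_r'; pose proof (Nat.pow_gt_lin_r 2 J); lia. }
  assert (Hlam : (2 ^ j < lam j)%nat) by (unfold lam; apply Nat.pow_gt_lin_r; lia).
  assert (Hn : (lam j < n)%nat) by (unfold n, dim; apply Nat.pow_gt_lin_r; lia).
  specialize (H1 n ltac:(lia)); specialize (H2 n ltac:(lia)).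
  specialize (H3 n ltac:(lia)); specialize (H4 n ltac:(lia)); cbv beta in *.
  assert (Hlog : log2 (INR n) = INR (lam j)) by apply log2_pow2.
  rewrite Hlog in H2, H3, H4.
  set (a := alpha n) in *; set (b := beta n) in *; set (la := log2 a) in *.
  rewrite !plus_INR in H1; change (INR 4) with (1 + 1 + 1 + 1) in H1.
  rewrite !plus_INR in H4; change (INR 4) with (1 + 1 + 1 + 1) in H4.
  pose proof (pos_INR c1); pose proof (pos_INR c2); pose proof (pos_INR (lam j)).
  assert (Ha1 : 1 <= a) by lra.
  assert (Hla : 0 <= la) by now apply log2_nonneg.
  assert (Hpair : forall u, (u < pairs n)%nat ->
    dep U (fst_str n u) (snd_str n u) <= a ->
    s n <= INR (Defs.C U (fst_str n u)) -> s n <= INR (Defs.C U (snd_str n u)) ->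
    dep U (value f1 n u) (value f2 n u) <= b /\
    b + 8 * INR (lam j) <= INR (Defs.C U (value f1 n u)) /\
    b + 8 * INR (lam j) <= INR (Defs.C U (value f2 n u))).
  { intros u _ Hd Hx Hy; rewrite <- Hlog.
    apply (Hred n); [apply str_length..|assumption|assumption|assumption]. }
  assert (Hdep : forall z1 z2, INR (Defs.C U z1) - INR (Ccond U z1 z2) <= dep U z1 z2)
    by (intros; apply Rmax_l).
  (* [beta n] may be negative, but dependencies are at least [- c2]. *)
  destruct (Rlt_or_le b (- INR c2)) as [Hb|Hb].
  (* Any random pair serves, hence [m = 0] and the trivial predicate: its dependency is at most
     [3 + c1 <= c0 <= alpha n]. *)
  { destruct (random_pair_dep U c1 c2 n 0 (fun _ => true) HU Hc1 Hc2)
      as [u [Hu [_ [Hd [Hx Hy]]]]].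
    - lia.
    - rewrite sum_const; simpl; lia.
    - change (0 + 3)%nat with 3%nat in *.
      apply le_INR in Hx, Hy.
      rewrite !plus_INR in Hd; rewrite !plus_INR in Hx; rewrite !plus_INR in Hy.
      change (INR 3) with (1 + 1 + 1) in *.
      destruct (Hpair u Hu) as [Hdz _]; [lra..|].
      specialize (Hdep (value f1 n u) (value f2 n u)).
      specialize (Hc2 (value f1 n u) (value f2 n u)).
      apply le_INR in Hc2; rewrite plus_INR in Hc2; lra. }
  (* As [b >= - c2], [a] is at least [lam j - c2], hence at least [lam j / 2 = 2^(2^j - 1)]. So
     [log alpha] outgrows [j] and all the constants. *)
  assert (Hla2 : INR (2 ^ j - 1) <= la).
  { rewrite <- log2_pow2; apply log2_le; [apply lt_0_INR, pow2_pos|].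
    assert (E : lam j = (2 ^ (2 ^ j - 1) + 2 ^ (2 ^ j - 1))%nat).
    { unfold lam; replace (2 ^ j)%nat with (S (2 ^ j - 1)) at 1 by lia.
      rewrite Nat.pow_succ_r'; lia. }
    assert (Hc : (2 * c2 <= lam j)%nat) by lia.
    apply le_INR in Hc; rewrite mult_INR in Hc; change (INR 2) with (1 + 1) in Hc.
    apply (f_equal INR) in E; rewrite plus_INR in E; lra. }
  assert (Hj' : (J + j <= 2 ^ j - 1)%nat) by lia.
  pose proof (le_INR _ _ Hj') as HjR.
  assert (HJ : INR (c1 + c2 + cl + ch + cv + 10) <= INR J) by (apply le_INR; lia).
  rewrite !plus_INR in HJ; change (INR 10) with (1+1+1+1+1+1+1+1+1+1) in HJ.
  rewrite plus_INR in HjR.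
  pose proof (pos_INR cl); pose proof (pos_INR ch); pose proof (pos_INR cv).
  pose proof (pos_INR j).
  (* The difference equals [b + 3 la], which is nonnegative because [b >= - c2] and [la >= c2]. *)
  destruct (nat_floor (a - INR (lam j))) as [m [Hm Hm']]; [lra|].
  assert (HlamR : INR J + INR j + 1 <= INR (lam j)).
  { rewrite <- plus_INR, <- S_INR; apply le_INR; lia. }
  assert (HnR : INR (lam j) <= INR n) by (apply le_INR; lia).
  destruct (relation_spec f1 f2 n m) as [Hrel _]; [lia|].
  destruct (random_pair_dep U c1 c2 n m
    (fun u => Nat.testbit (relation f1 f2 n m) (cell f1 f2 n u)) HU Hc1 Hc2)
    as [u [Hu [HP [Hd [Hx Hy]]]]]; [|exact Hrel|].
  { apply INR_le; rewrite plus_INR; change (INR 3) with (1 + 1 + 1); lra. }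
  apply le_INR in Hx, Hy.
  rewrite !plus_INR in Hd; rewrite !plus_INR in Hx; rewrite !plus_INR in Hy.
  change (INR 3) with (1 + 1 + 1) in *.
  destruct (Hpair u Hu) as [Hdz [Hz1 Hz2]]; [lra..|].
  assert (Hlan : la <= INR (lam j)).
  { rewrite <- Hlog; apply log2_le; lra. }
  set (k := Defs.C U (value f1 n u)) in *.
  (* [beta + 8 log n] is at least [m - 3 log alpha + 8 log n], and [log alpha <= log n]. *)
  assert (Hk : (m + 5 * lam j <= k)%nat).
  { apply INR_le; rewrite plus_INR, mult_INR; change (INR 5) with (1 + 1 + 1 + 1 + 1); lra. }
  destruct (heavy U f1 f2 n m k (rep f2 n u)) eqn:E.
  - assert (Hz := Hheavy j m k u Hu ltac:(lia) ltac:(lia) E); fold n in Hz.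
    assert (Hlogk : (Nat.log2 k <= lam j + 2)%nat).
    { assert (Hkn : (k <= 2 ^ (lam j + 2))%nat).
      { specialize (Hvalue j u Hu); fold n in Hvalue; fold k in Hvalue.
        rewrite Nat.pow_add_r; fold (dim j); fold n; simpl (2 ^ 2)%nat; lia. }
      rewrite <- (Nat.log2_pow2 (lam j + 2)) by lia; now apply Nat.log2_le_mono. }
    (* The description has at most [m + 3 lam j + j + 6 + ch] bits, and [2 lam j] exceeds
       [j + 6 + ch]. *)
    assert (Hzz : (Defs.C U (value f2 n u) < m + 5 * lam j)%nat) by lia.
    apply lt_INR in Hzz; rewrite plus_INR, mult_INR in Hzz.
    change (INR 5) with (1 + 1 + 1 + 1 + 1) in Hzz; lra.
  - assert (Hz := Hlight j m k u Hu HP eq_refl ltac:(lia) E); fold n in Hz.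
    specialize (Hdep (value f1 n u) (value f2 n u)); fold k in Hdep.
    assert (Hz' : (Ccond U (value f1 n u) (value f2 n u) + m
                   <= j + (Nat.log2 m + Nat.log2 m) + (k + 3) + cl)%nat) by lia.
    apply le_INR in Hz'; rewrite !plus_INR in Hz'; change (INR 3) with (1 + 1 + 1) in Hz'.
    (* The dependency is then at least [m - 2 la - j - 3 - cl], and [m > a - lam j - 1]; this
       exceeds [b = a - lam j - 3 la] because [la > j + cl + 4]. *)
    assert (Hlm : INR (Nat.log2 m) <= la) by (apply nat_log2_le; lra).
    lra.
Qed.
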